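(* Let $G$ be a finite group and $N\trianglelefteq G$. Then $$\operatorname{ed}(G/N)\leq \operatorname{ed}(G)\,h(\operatorname{ed}(G))\,j\bigl(\operatorname{ed}(G)\,h(\operatorname{ed}(G))\bigr),$$ where $j$ is a bounding function in Jordan's theorem and $h$ is a bounding function for the Jordan property of birational automorphism groups of rationally connected varieties.
   Context: For a finite group $G$, $\operatorname{ed}(G)$ denotes the essential dimension of $G$ over $\mathbb{C}$: the minimal dimension of an irreducible complex algebraic variety $X$ with a faithful $G$-action for which there exists a $G$-equivariant dominant rational map $V\dashrightarrow X$, where $V$ is a faithful finite-dimensional complex linear representation of $G$ (the value does not depend on $V$). A bounding function in Jordan's theorem is an integer-valued function $j$ such that, for every nonnegative integer $n$, every finite group $H$ that embeds into $\operatorname{GL}(n,\mathbb{C})$ has an abelian normal subgroup $A\trianglelefteq H$ with $|H:A|\leq j(n)$. The function $h$ is a positive-integer-valued function such that, for every nonnegative integer $d$ and every rationally connected complex variety $X$ of dimension $d$, every finite subgroup of the group $\operatorname{Bir}(X)$ of birational automorphisms of $X$ contains an abelian normal subgroup of index at most $h(d)$ (the existence of such a function is a theorem of Birkar). *)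

(* Defs.v *)
From HB Require Import structures.
From mathcomp Require Import all_boot all_order all_algebra all_fingroup.
From mathcomp Require Import all_character.
From mathcomp Require Import mpoly.
From mathcomp Require Import boolp classical_sets reals topology.
From mathcomp Require Import complex.

Set Implicit Arguments.
Unset Strict Implicit.
Unset Printing Implicit Defensive.

Import GRing.Theory.
Local Open Scope classical_set_scope.
Local Open Scope ring_scope.

(* Varieties are spaces with functions (Serre, FAC): a topological space with
   a sheaf of K-valued functions, locally isomorphic to an affine algebraic
   set. They are meant for an algebraically closed field K and are used with
   K = R[i]. *)

Section AffineSpace.
Variables (K : fieldType) (n : nat).

Definition affine_space : Type := 'rV[K]_n.

HB.instance Definition _ := Choice.on affine_space.

Definition peval (p : {mpoly K[n]}) (v : affine_space) : K :=
  p.@[fun i => (v : 'rV[K]_n) 0 i].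

Definition zeros (S : set {mpoly K[n]}) : set affine_space :=
  [set v | forall p, S p -> peval p v = 0].

Definition zariski_open (U : set affine_space) : Prop :=
  exists S, U = ~` zeros S.

Lemma zariski_openT : zariski_open setT.
Proof.
exists [set 1]; apply/seteqP; split=> // v _ /(_ 1 erefl).
by rewrite /peval meval1 => /eqP; rewrite oner_eq0.
Qed.

Lemma zariski_openI : setI_closed zariski_open.
Proof.
move=> _ _ [S ->] [T ->].
exists [set pq.1 * pq.2 | pq in [set pq | S pq.1 /\ T pq.2]].
rewrite -setCU; congr (~` _); apply/seteqP; split=> [v|v ST0].
  case=> v0 _ [[p q] /= [Sp Tq]] <-.
    by rewrite /peval mevalM [X in X * _](v0 p Sp) mul0r.
  by rewrite /peval mevalM [X in _ * X](v0 q Tq) mulr0.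
have [?|/existsNP[p /not_implyP[Sp p0]]] := pselect (zeros S v); [by left|].
right=> q Tq; have /eqP : peval (p * q) v = 0 by apply: ST0; exists (p, q).
by rewrite /peval mevalM mulf_eq0 => /orP[/eqP/p0//|/eqP].
Qed.

Lemma zariski_open_bigU (I : Type) (f : I -> set affine_space) :
  (forall i, zariski_open (f i)) -> zariski_open (\bigcup_i f i).
Proof.
move=> /choice[S fS]; exists (\bigcup_i S i).
apply/seteqP; split=> [v [i _]|v /existsNP[p /not_implyP[[i _ Sp] p0]]].
  by rewrite fS => vi /= v0; apply: vi => p Sp; apply: v0; exists i.
by exists i => //; rewrite fS => v0; apply: p0; apply: v0.
Qed.

HB.instance Definition _ := isOpenTopological.Build affine_space
  zariski_openT zariski_openI zariski_open_bigU.

End AffineSpace.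

(* The sheaf is given by its germs: [regular_at x f] says that f coincides near
   x with a section of the sheaf; the sections over an open set U are the
   functions that are regular at every point of U, their values outside U
   being irrelevant. *)
Record space (K : fieldType) := Space {
  carrier :> topologicalType;
  regular_at : carrier -> (carrier -> K) -> Prop
}.

Section Varieties.
Variable K : fieldType.
Implicit Types X Y : space K.

Definition regular_on X (U : set X) (f : X -> K) : Prop :=
  forall x, U x -> regular_at x f.

Definition affine (n : nat) : space K :=
  @Space K (affine_space K n) (fun x f => exists p q : {mpoly K[n]},
    peval q x != 0 /\ \forall y \near x, f y = peval p y / peval q y).

(* [phi] restricts to an isomorphism from the open subspace U of X onto a
   closed algebraic subset of affine n-space *)
Definition affine_chart X (U : set X) n (phi : X -> affine n) : Prop :=
  [/\ open U,
      {in U &, injective phi},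
      closed (phi @` U),
      forall W : set X, W `<=` U ->
        (open W <-> exists O : set (affine n), open O /\ W = U `&` phi @^-1` O)
    & forall x (f : X -> K), U x ->
        (regular_at x f <-> exists p q : {mpoly K[n]},
           peval q (phi x) != 0 /\
           \forall y \near x, f y = peval p (phi y) / peval q (phi y))].

Definition prevariety X : Prop :=
  exists (m : nat) (U : 'I_m -> set X),
    \bigcup_i U i = setT /\
    forall i, exists n (phi : X -> affine n), affine_chart (U i) phi.

(* Open sets of the product variety X * Y: a base of its topology consists of
   the loci of U * V where a function sum_i f_i(x) g_i(y) does not vanish. This
   is strictly finer than the product topology that X * Y carries as a
   [topologicalType]. *)
Definition prod_open X Y (W : set (X * Y)) : Prop :=
  forall x y, W (x, y) ->
  exists (U : set X) (V : set Y) (m : nat)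
         (f : 'I_m -> X -> K) (g : 'I_m -> Y -> K),
  [/\ [/\ open U, open V, U x & V y],
      forall i, regular_on U (f i),
      forall i, regular_on V (g i),
      \sum_i f i x * g i y != 0
    & forall x' y', U x' -> V y' -> \sum_i f i x' * g i y' != 0 -> W (x', y')].

Definition separated_space X : Prop :=
  prod_open [set xy : X * X | xy.1 <> xy.2].

Definition irreducible_space X : Prop :=
  [set: X] !=set0 /\
  forall U V : set X, open U -> open V -> U !=set0 -> V !=set0 ->
    U `&` V !=set0.

Definition variety X : Prop :=
  [/\ prevariety X, separated_space X & irreducible_space X].

(* [d] is the transcendence degree of the function field of X, whose elements
   are represented by functions regular on a nonempty open set *)
Definition alg_indep_functions X (d : nat) : Prop :=
  exists (U : set X) (f : 'I_d -> X -> K),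
  [/\ open U, U !=set0, forall i, regular_on U (f i)
    & forall p : {mpoly K[d]},
        (forall x, U x -> p.@[fun i => f i x] = 0) -> p = 0].

Definition dimension X (d : nat) : Prop :=
  alg_indep_functions X d /\
  forall e, alg_indep_functions X e -> (e <= d)%N.

Definition morphism_on X Y (U : set X) (f : X -> Y) : Prop :=
  forall x, U x ->
    {for x, continuous f} /\
    forall g : Y -> K, regular_at (f x) g -> regular_at x (g \o f).

(* a representative of a rational map; [rfun] is meaningful on [rdom] only *)
Record ratmap X Y := RatMap {
  rdom : set X;
  rfun :> X -> Y;
  rdom_open : open rdom;
  rdom_neq0 : rdom !=set0;
  rfun_morphism : morphism_on rdom rfun
}.

Definition dominant X Y (f : ratmap X Y) : Prop := dense (f @` rdom f).

Definition generically X (P : set X) : Prop :=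
  exists W : set X, [/\ open W, W !=set0 & W `<=` P].

Definition rat_eq X Y (f g : ratmap X Y) : Prop :=
  generically [set x | [/\ rdom f x, rdom g x & f x = g x]].

(* g o f = h as rational maps *)
Definition rat_comp_eq X Y Z
    (g : ratmap Y Z) (f : ratmap X Y) (h : ratmap X Z) : Prop :=
  generically [set x | [/\ rdom f x, rdom g (f x), rdom h x & g (f x) = h x]].

Definition rat_inverse X Y (f : ratmap X Y) (g : ratmap Y X) : Prop :=
  generically [set x | [/\ rdom f x, rdom g (f x) & g (f x) = x]].

Definition birational X Y (f : ratmap X Y) : Prop :=
  exists g : ratmap Y X, rat_inverse f g /\ rat_inverse g f.

(* an injective group homomorphism from H to Bir(X), the group of birational
   maps from X to itself modulo [rat_eq] *)
Definition Bir_embedding (gT : finGroupType) (H : {group gT}) X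
    (rho : gT -> ratmap X X) : Prop :=
  [/\ {in H, forall g, birational (rho g)},
      {in H &, forall g h, rat_comp_eq (rho g) (rho h) (rho (g * h)%g)}
    & {in H &, forall g h, rat_eq (rho g) (rho h) -> g = h}].

(* A general pair of points lies on a rational curve. X is not assumed proper,
   so that a rational curve in X is parametrized by an open subset of the
   projective line; as this subset can be shrunk while keeping preimages of
   the two points, it may be taken in the affine line. *)
Definition rationally_connected X : Prop :=
  exists W : set (X * X),
  [/\ prod_open W, W !=set0
    & forall x y, W (x, y) -> exists c : ratmap (affine 1) X,
        (c @` rdom c) x /\ (c @` rdom c) y].

(* As for matrix representations, actions are right actions. *)
Definition regular_action (gT : finGroupType) (G : {group gT}) X
    (to : action G X) : Prop :=
  {in G, forall g, morphism_on [set: X] (fun x => to x g)}.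

Definition faithful_action (gT : finGroupType) (G : {group gT}) X
    (to : action G X) : Prop :=
  {in G, forall g, (forall x, to x g = x) -> g = 1%g}.

Definition equivariant (gT : finGroupType) (G : {group gT}) n
    (rG : mx_representation K G n) X (to : action G X)
    (f : ratmap (affine n) X) : Prop :=
  {in G, forall g (v : 'rV[K]_n), rdom f v -> rdom f (v *m rG g) ->
    f (v *m rG g) = to (f v) g}.

(* X is the target, of dimension d, of a compression of a faithful linear
   representation of G *)
Definition compression_dim (gT : finGroupType) (G : {group gT}) (d : nat)
    : Prop :=
  exists n (rG : mx_representation K G n) (X : space K) (to : action G X)
         (f : ratmap (affine n) X),
  [/\ mx_faithful rG,
      variety X /\ dimension X d,
      regular_action to /\ faithful_action to,
      dominant f
    & equivariant rG to f].

(* the least d such that [compression_dim G d]; the representation varies along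
   with X, which is harmless as the minimum for a fixed faithful representation
   does not depend on it *)
Definition ed (gT : finGroupType) (G : {group gT}) : nat :=
  xget 0%N [set d | compression_dim G d /\
                    forall e, compression_dim G e -> (d <= e)%N].

Definition jordan_bounding (j : nat -> int) : Prop :=
  forall (n : nat) (gT : finGroupType) (H : {group gT}),
    (exists rH : mx_representation K H n, mx_faithful rH) ->
    exists A : {group gT},
      [/\ (A <| H)%g, abelian A & (#|H : A|%g%:Z <= j n)%R].

Definition rc_bounding (h : nat -> nat) : Prop :=
  (forall d, (0 < h d)%N) /\
  forall (d : nat) (X : space K),
    variety X -> rationally_connected X -> dimension X d ->
    forall (gT : finGroupType) (H : {group gT}),
      (exists rho : gT -> ratmap X X, Bir_embedding H rho) ->
      exists A : {group gT},
        [/\ (A <| H)%g, abelian A & (#|H : A|%g <= h d)%N].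

End Varieties.

(* Main.v *)
Require Import Defs.
From HB Require Import structures.
From mathcomp Require Import all_boot all_order all_algebra all_fingroup.
From mathcomp Require Import all_solvable all_field all_character.
From mathcomp Require Import mpoly.
From mathcomp Require Import boolp classical_sets reals topology.
From mathcomp Require Import complex ring zify.

Set Implicit Arguments.
Unset Strict Implicit.
Unset Printing Implicit Defensive.

Import Order.TTheory GRing.Theory Num.Theory.
Local Open Scope classical_set_scope.
Local Open Scope ring_scope.

(* Let V --> X be a compression of G with dim X = d = ed G.

   An abelian subgroup A of G has rank at most d: as A acts faithfully on X,
   each character of A is the weight of a rational function on X, obtained by
   averaging a function that separates a free orbit. Pull these functions back
   to V and diagonalize A there. The leading monomial of a semi-invariant of
   weight theta has weight theta, so for characters dual to a basis of A the
   leading exponents are linearly independent, and therefore the functions are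
   algebraically independent.

   The image of V --> X contains a nonempty open set, which is connected by the
   images of lines of V. Hence X is rationally connected and G has an abelian
   normal subgroup A of index at most h d. Its image in G / N has rank at most d
   and index at most h d. The sum of the representations induced from d jointly
   faithful characters of this image is a faithful representation of G / N of
   dimension at most d * h d. Finally j >= 1, by Jordan's property of the trivial
   group. *)

(** * Multivariate polynomials *)

(** A compression of [G] does not simply descend to [G / N], because the quotient of a linear
    representation by [N] need not be linear. What descends is an abelian normal subgroup of bounded
    index and bounded rank, since the rank of an abelian group does not grow in quotients. The
    compression of [G] therefore serves only to extract these two numbers, and [ed] of [G / N] is
    bounded by the dimension of a faithful representation, whose identity map is a compression. The
    rank has to be bounded by dim X, as dim V can be arbitrarily large. Weights of elements of
    finite order determine integer exponents only modulo these orders, so linear independence of the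
    leading exponents needs a descent. That the image contains an open set is Chevalley's theorem,
    obtained by extending homomorphisms into an algebraically closed field. *)

Lemma mpoly_rmorph_eq (n : nat) (A B : comNzRingType)
    (g1 g2 : {rmorphism {mpoly A[n]} -> B}) :
  (forall c, g1 c%:MP = g2 c%:MP) -> (forall i, g1 'X_i = g2 'X_i) -> g1 =1 g2.
Proof.
move=> eqC eqX p; rewrite [p]mpolyE !rmorph_sum; apply: eq_bigr => m _.
rewrite -mul_mpolyC !rmorphM /= eqC mpolyXE_id !rmorph_prod; congr (_ * _).
by apply: eq_bigr => i _; rewrite !rmorphXn /= eqX.
Qed.

Lemma rmorph_mmap (n : nat) (A B C : comNzRingType) (f : {rmorphism A -> B})
    (g : {rmorphism B -> C}) (h : 'I_n -> B) (p : {mpoly A[n]}) :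
  g (mmap f h p) = mmap (g \o f) (g \o h) p.
Proof.
by apply: (mpoly_rmorph_eq (g1 := g \o mmap f h) (g2 := mmap (g \o f) (g \o h)))
   => [c|i] /=; rewrite ?mmapC // !mmapX !mmap1U.
Qed.

Lemma eq_mmap (n : nat) (A B : nzRingType) (f1 f2 : A -> B) (h1 h2 : 'I_n -> B) :
  f1 =1 f2 -> h1 =1 h2 -> mmap f1 h1 =1 mmap f2 h2.
Proof.
move=> ef eh p; apply: eq_bigr => m _; rewrite ef; congr (_ * _).
exact: mmap1_eq.
Qed.

Definition polyn_eval n (A : comNzRingType) :
    {rmorphism {poly {mpoly A[n]}} -> {mpoly A[n.+1]}} :=
  (horner_eval ('X_ord_max : {mpoly A[n.+1]}) \o map_poly (@mwiden n A)).

Lemma muniK n (A : comNzRingType) : cancel (@muni n A) (polyn_eval n A).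
Proof.
apply: (mpoly_rmorph_eq (g1 := polyn_eval n A \o @muni n A) (g2 := idfun)).
  by move=> c /=; rewrite muniC /= map_polyC horner_evalE hornerC /= mwidenC.
move=> i /=; rewrite /muni mmapX mmap1U.
case: splitP => [j ij|j ij] /=.
  rewrite map_polyC horner_evalE hornerC /= mwidenX mnmwiden1.
  by congr 'X_[U_( _)]; apply: val_inj.
rewrite map_polyX horner_evalE hornerX.
by congr 'X_[U_( _)]; apply: val_inj; rewrite /= [RHS]ij ord1 addn0.
Qed.

Lemma poly_nonroot (K : numFieldType) (p : {poly K}) : p != 0 -> exists c, p.[c] != 0.
Proof.
move=> p0; apply: contrapT => /forallNP p_root.
(* Otherwise the integers 0, ..., size p - 1, distinct in characteristic 0, would be too many
   roots. *)
have /(max_poly_roots p0) : all (root p) [seq k%:R | k <- iota 0 (size p)].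
  by apply/allP => c _; apply/rootP; have /negP/negPn/eqP := p_root c.
rewrite map_inj_uniq ?iota_uniq ?size_map ?size_iota ?ltnn; first by move=> /(_ isT).
by move=> a b /eqP; rewrite eqr_nat => /eqP.
Qed.

Lemma muni_meval n (K : comNzRingType) (v : 'I_n.+1 -> K) (p : {mpoly K[n.+1]}) :
  p.@[v] = (map_poly (meval (v \o widen_ord (leqnSn n))) (muni p)).[v ord_max].
Proof.
apply: (mpoly_rmorph_eq (g1 := meval v)
  (g2 := horner_eval (v ord_max) \o map_poly (meval (v \o widen_ord (leqnSn n)))
         \o @muni n K)).
  by move=> c /=; rewrite muniC /= map_polyC horner_evalE hornerC /= !mevalC.
move=> i /=; rewrite mevalXU /muni mmapX mmap1U.
case: splitP => [j ij|j ij] /=.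
  rewrite map_polyC horner_evalE hornerC /= mevalXU /=.
  by congr v; apply: val_inj.
rewrite map_polyX horner_evalE hornerX.
by congr v; apply: val_inj; rewrite /= [LHS]ij ord1 addn0.
Qed.

Lemma mpoly_nonzero (K : numFieldType) n (p : {mpoly K[n]}) :
  p != 0 -> exists v, p.@[v] != 0.
Proof.
elim: n p => [|n IH] p p0.
  exists (fun => 0); rewrite (nvar0_mpolyC p) mevalC.
  by apply: contraNneq p0 => p00; rewrite (nvar0_mpolyC p) p00 mpolyC0.
have q0 : muni p != 0.
  by apply: contraNneq p0 => q0; rewrite -[p]muniK q0 rmorph0.
have /IH[w w0] : lead_coef (muni p) != 0 by rewrite lead_coef_eq0.
have /poly_nonroot[c c0] : map_poly (meval w) (muni p) != 0.
  by apply: contraNneq w0 => /(congr1 (coefp (size (muni p)).-1)) /=;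
     rewrite coef0 coef_map => ->.
pose v (i : 'I_n.+1) := if unlift ord_max i is Some j then w j else c.
exists v; rewrite muni_meval /v unlift_none; apply: contraNneq c0 => E; apply/eqP.
rewrite -[RHS]E; congr (_.[c]); apply: eq_map_poly => q; apply: meval_eq => j /=.
have -> : widen_ord (leqnSn n) j = lift ord_max j.
  by apply: val_inj; rewrite /= /bump leqNgt ltn_ord.
by rewrite liftK.
Qed.

(* q ^+ N * T(p / q), provided that N is at least the degree of T *)
Definition homogenize m n (K : comNzRingType) (N : nat)
    (p : 'I_m -> {mpoly K[n]}) (q : {mpoly K[n]}) (T : {mpoly K[m]}) :
    {mpoly K[n]} :=
  \sum_(a <- msupp T) T@_a *: (\prod_i p i ^+ a i * q ^+ (N - mdeg a)).

(** The homomorphism [e] is arbitrary so as to cover both evaluation at a point and the embedding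
    into the fraction field. *)
Lemma homogenizeE m n (K : comNzRingType) (L : fieldType) N
    (e : {rmorphism {mpoly K[n]} -> L}) (p : 'I_m -> {mpoly K[n]}) q
    (T : {mpoly K[m]}) :
  (msize T <= N.+1)%N -> e q != 0 ->
  e (homogenize N p q T) =
    e q ^+ N * mmap (e \o @mpolyC n K) (fun i => e (p i) / e q) T.
Proof.
move=> TN q0; rewrite rmorph_sum /mmap mulr_sumr /=.
rewrite big_seq [RHS]big_seq; apply: eq_bigr => a aT.
rewrite -mul_mpolyC !rmorphM [RHS]mulrCA; congr (_ * _) => /=.
rewrite rmorphXn rmorph_prod /mmap1.
have aN : (mdeg a <= N)%N by rewrite -ltnS (leq_trans (msize_mdeg_lt aT)).
rewrite -[in e q ^+ N](subnKC aN) exprD mulrAC; congr (_ * _).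
rewrite mdegE -prodrXr -big_split /=; apply: eq_bigr => i _.
by rewrite -exprMn mulrC divfK // rmorphXn.
Qed.


(** * Extension of specializations *)

Section PseudoDivision.
Variable A : comNzRingType.
Implicit Types M P R : {poly A}.

Lemma size_reduce M R : R != 0 -> (size R <= size M)%N ->
  (size (lead_coef R *: M - lead_coef M *: 'X^(size M - size R) * R)%R
    < size M)%N.
Proof.
move=> R0 RM; have sR : (0 < size R)%N by rewrite size_poly_gt0.
have sM := leq_trans sR RM.
rewrite -[ltnRHS]prednK // ltnS; apply/leq_sizeP => i Mi.
rewrite coefB coefZ -scalerAl coefZ coefXnM.
have -> : (i < size M - size R)%N = false.
  by apply/negbTE; rewrite -leqNgt (leq_trans _ Mi) // -subn1 leq_sub2l.
have [i_eq|] := eqVneq i (size M).-1.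
  rewrite i_eq; have -> : ((size M).-1 - (size M - size R) = (size R).-1)%N.
    by rewrite -!subn1 -subnAC subKn.
  by rewrite -!lead_coefE mulrC subrr.
move=> i_neq; have {i_neq Mi} iM : (size M <= i)%N.
  by rewrite -(prednK sM) ltn_neqAle eq_sym i_neq.
rewrite (nth_default _ iM) mulr0 sub0r nth_default ?mulr0 ?oppr0 //.
by rewrite leq_subRL ?(leq_trans (leq_subr _ _) iM) // subnK.
Qed.

(** The bound on [Q] serves in [algebraic_inverse], where the quotient has to be shorter than the
    dividend. *)
Lemma pseudo_division M R : R != 0 ->
  exists N (Q : {poly A}), (size (lead_coef R ^+ N *: M - Q * R)%R < size R)%N /\
              (size Q <= (size M - size R).+1)%N.
Proof.
move=> R0; have [n] := ubnP (size M); elim: n M => // n IH M Mn.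
have [MR|RM] := ltnP (size M) (size R).
  by exists 0%N, 0; rewrite expr0 scale1r mul0r subr0 size_poly0.
have sM' := size_reduce R0 RM.
have [|N [Q [szR szQ]]] := IH _ (leq_trans sM' _); first by rewrite -ltnS.
exists N.+1, (Q + lead_coef R ^+ N *: (lead_coef M *: 'X^(size M - size R))).
split.
  move: szR; congr (size (polyseq _) < _)%N.
  rewrite scalerBr -!mul_polyC exprSr polyCM; ring.
rewrite (leq_trans (size_polyD _ _)) // geq_max; apply/andP; split.
  by rewrite (leq_trans szQ) // ltnS leq_sub2r // ltnW.
rewrite !(leq_trans (size_scale_leq _ _)) //.
by rewrite size_polyXn.
Qed.

Lemma drop_lead_coef P : P != 0 ->
  exists2 P' : {poly A}, (size P' < size P)%N
    & P = P' + lead_coef P *: 'X^((size P).-1).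
Proof.
move=> P0; have sP : (0 < size P)%N by rewrite size_poly_gt0.
exists (take_poly (size P).-1 P).
  by rewrite -[ltnRHS]prednK // ltnS size_take_poly.
apply/polyP => i; rewrite coefD coef_take_poly coefZ coefXn.
have [lti|gti|->] := ltngtP i (size P).-1; rewrite ?mulr0 ?addr0 ?add0r ?mulr1 //.
by rewrite nth_default // -(prednK sP).
Qed.

End PseudoDivision.

(* An integral domain generated over alpha(A) inside F is described by alpha and
   its generators b. The homomorphisms phi : A -> K with ker alpha contained in
   ker phi are the points of Spec alpha(A). *)
Section Specialization.
Variables (F : idomainType) (K : numClosedFieldType).

Section OneGenerator.
Variables (A : comNzRingType) (alpha : {rmorphism A -> F}) (b : F).
Let ev : {rmorphism {poly A} -> F} := horner_eval b \o map_poly alpha.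

Lemma evE P : ev P = (map_poly alpha P).[b]. Proof. by []. Qed.

Lemma evC c : ev c%:P = alpha c.
Proof. by rewrite evE map_polyC hornerC. Qed.

Section Algebraic.
Variable mu : {poly A}.
Hypotheses (mu_root : ev mu = 0) (mu_lead : alpha (lead_coef mu) != 0).
Hypothesis mu_min : forall P : {poly A},
  (size P < size mu)%N -> ev P = 0 -> map_poly alpha P = 0.

Let mu0 : mu != 0.
Proof. by apply: contraNneq mu_lead => ->; rewrite lead_coef0 rmorph0. Qed.

(** Reduction modulo [mu] multiplies [P] by leading coefficients that [phi] does not kill, until [P]
    is shorter than [mu]; by minimality its coefficients then lie in ker alpha, hence in ker phi. *)
Lemma specialize_root (phi : {rmorphism A -> K}) (c : K) :
  (forall u, alpha u = 0 -> phi u = 0) -> phi (lead_coef mu) != 0 ->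
  root (map_poly phi mu) c ->
  forall P, ev P = 0 -> (map_poly phi P).[c] = 0.
Proof.
move=> ker lead0 /rootP rc P; have [n] := ubnP (size P).
elim: n P => // n IH P Pn P0.
have [Pmu|muP] := ltnP (size P) (size mu).
  have PE := mu_min Pmu P0; suff -> : map_poly phi P = 0 by rewrite horner0.
  apply/polyP => i; rewrite coef_map coef0 /= ker // -coef_map /= PE.
  by rewrite coef0.
have /(leq_trans (size_reduce mu0 muP))/IH : (size P <= n)%N by rewrite -ltnS.
have -> : ev (lead_coef mu *: P
     - lead_coef P *: 'X^(size P - size mu) * mu) = 0.
  by rewrite -mul_polyC rmorphB !rmorphM P0 mu_root !mulr0 subr0.
move=> /(_ erefl); rewrite -!mul_polyC rmorphB !rmorphM /= hornerD hornerN.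
rewrite !hornerM rc mulr0 subr0 map_polyC hornerC => /eqP.
by rewrite mulf_eq0 (negbTE lead0) => /eqP.
Qed.

(* A nonzero algebraic element has a nonzero multiple among the scalars: divide
   the minimal relation mu by R and continue with the remainder. *)
Lemma algebraic_inverse R : ev R != 0 ->
  exists u r, alpha r != 0 /\ ev (u * R) = alpha r.
Proof.
have [n] := ubnP (size R); elim: n R => // n IH R Rn R0.
have Rneq0 : R != 0 by apply: contraNneq R0 => ->; rewrite rmorph0.
have [Rmu|muR] := ltnP (size R) (size mu); last first.
  have /(leq_trans (size_reduce mu0 muR))/IH : (size R <= n)%N by rewrite -ltnS.
  have E : ev (lead_coef mu *: R - lead_coef R *: 'X^(size R - size mu) * mu)
     = alpha (lead_coef mu) * ev R.
    rewrite -mul_polyC rmorphB !rmorphM mu_root mulr0 subr0.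
    by rewrite evC.
  rewrite E mulf_neq0 // => /(_ isT)[u [r [r0 ur]]].
  exists (u * (lead_coef mu)%:P), r; split => //.
  by rewrite -ur -mulrA !rmorphM E evC.
have [R1|R1] := leqP (size R) 1.
  exists 1, R`_0; move: R0; rewrite [R]size1_polyC // evC => r0.
  by rewrite coefC eqxx mul1r evC.
(* [alpha] may kill the leading coefficient of [R]; dropping that term leaves [ev R] unchanged. *)
have [lR0|lR0] := eqVneq (alpha (lead_coef R)) 0.
  have [R' R'R RE] := drop_lead_coef Rneq0.
  have E : ev R = ev R'.
    rewrite RE rmorphD -mul_polyC rmorphM evC.
    by rewrite lR0 mul0r addr0.
  have /IH : (size R' < n)%N by rewrite (leq_trans R'R) // -ltnS.
  rewrite -E => /(_ R0)[u [r [r0 ur]]]; exists u, r; split => //.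
  by rewrite -ur !rmorphM E.
have [N [Q [szS szQ]]] := pseudo_division mu Rneq0.
set S := _ - _ in szS.
have SE : ev S = - (ev Q * ev R).
  by rewrite /S -mul_polyC rmorphB !rmorphM mu_root mulr0 sub0r.
have [S0|S0] := eqVneq (ev S) 0.
  (* Here [Q] also vanishes at [b]. Both [S] and [Q] are shorter than [mu], so [alpha] kills them,
     hence also [lead_coef R ^+ N *: mu], against [mu_lead]. *)
  exfalso.
  have Q0 : ev Q = 0.
    by move/eqP: S0; rewrite SE oppr_eq0 mulf_eq0 (negbTE R0) orbF => /eqP.
  have /mu_min/(_ S0) : (size S < size mu)%N by exact: ltn_trans Rmu.
  have /mu_min/(_ Q0) : (size Q < size mu)%N.
    rewrite (leq_ltn_trans szQ) // -subSn ?(ltnW Rmu) // ltn_subLR ?leqW ?(ltnW Rmu) //.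
    by rewrite -[X in (X < _)%N]add1n ltn_add2r.
  rewrite /S -mul_polyC rmorphB !rmorphM /= => ->; rewrite mul0r subr0.
  move=> /(congr1 (coefp (size mu).-1)) /=.
  rewrite map_polyC coefCM coef_map coef0 /= -lead_coefE rmorphXn => /eqP.
  by rewrite mulf_eq0 (negbTE mu_lead) expf_eq0 (negbTE lR0) andbF.
have /IH/(_ S0)[u [r [r0 ur]]] : (size S < n)%N by rewrite (leq_trans szS) // -ltnS.
exists (- (u * Q)), r; split => //.
by rewrite -ur !(rmorphN, rmorphM) SE mulrN mulNr mulrA.
Qed.

End Algebraic.

(** If [b] is transcendental over alpha(A), any [c] avoiding the roots of [t] will do. Otherwise [c]
    has to be a root of a relation of minimal size. *)
Lemma specialize1 (t : {poly A}) : ev t != 0 ->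
  exists2 a : A, alpha a != 0 &
    forall phi : {rmorphism A -> K}, (forall u, alpha u = 0 -> phi u = 0) ->
    phi a != 0 ->
    exists2 c : K, forall P, ev P = 0 -> (map_poly phi P).[c] = 0
      & (map_poly phi t).[c] != 0.
Proof.
move=> t0.
have [trans|] := pselect (forall P, ev P = 0 -> map_poly alpha P = 0).
  have {}t0 : map_poly alpha t != 0.
    by apply: contraNneq t0 => E; rewrite evE E horner0.
  (* The highest coefficient of [t] that [alpha] does not kill. *)
  exists t`_(size (map_poly alpha t)).-1.
    by rewrite -coef_map -lead_coefE lead_coef_eq0.
  move=> phi ker ta.
  have /poly_nonroot[c tc] : map_poly phi t != 0.
    by apply: contraNneq ta => E; rewrite -coef_map /= E coef0.
  exists c => // P /trans PE; suff -> : map_poly phi P = 0 by rewrite horner0.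
  apply/polyP => i; rewrite coef_map coef0 /= ker // -coef_map /= PE.
  by rewrite coef0.
move=> /existsNP[P0 /not_implyP[evP0 /eqP P0neq0]].
pose good n := `[< exists P : {poly A},
  [/\ size P = n, ev P = 0 & map_poly alpha P != 0] >].
have ex : exists n, good n by exists (size P0); apply/asboolP; exists P0.
case: (ex_minnP ex) => _ /asboolP[mu [<- mu_root mu0]] mu_least.
have mu_min (P : {poly A}) : (size P < size mu)%N -> ev P = 0 -> map_poly alpha P = 0.
  move=> Pmu evP; apply/eqP; apply: contraTT Pmu => PE; rewrite -leqNgt.
  by apply: mu_least; apply/asboolP; exists P.
have mu_neq0 : mu != 0 by apply: contraNneq mu0 => ->; rewrite rmorph0.
have mu_lead : alpha (lead_coef mu) != 0.
  apply: contraNneq mu0 => lead0.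
  have [mu' lt_mu' muE] := drop_lead_coef mu_neq0.
  have E : map_poly alpha mu = map_poly alpha mu'.
    by rewrite muE rmorphD -mul_polyC rmorphM /= map_polyC /= lead0 mul0r addr0.
  by rewrite E mu_min // evE -E -evE.
have [u [r [r0 ur]]] := algebraic_inverse mu_root mu_lead mu_min t0.
(* The first factor keeps the degree of [mu] under [phi], so that a root [c] exists; the second
   keeps [t] nonzero at [c], because [u * t] specializes to [r]. *)
exists (lead_coef mu * r); first by rewrite rmorphM mulf_neq0.
move=> phi ker; rewrite rmorphM mulf_eq0 negb_or => /andP[lead0 phir0].
have size_mu : size (map_poly phi mu) = size mu by rewrite size_map_poly_id0.
have /closed_rootP[c rc] : size (map_poly phi mu) != 1%N.
  rewrite size_mu; apply: contra mu_lead => /eqP mu1.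
  have muE : mu = (mu`_0)%:P by apply: size1_polyC; rewrite mu1.
  by move: mu_root; rewrite muE lead_coefC evC => ->.
have spec := specialize_root mu_root mu_lead mu_min ker lead0 rc.
exists c => //; apply: contraNneq phir0 => tc0.
have /spec : ev (u * t - r%:P) = 0.
  by rewrite rmorphB ur evC subrr.
rewrite rmorphB rmorphM /= hornerD hornerN hornerM tc0 mulr0 map_polyC hornerC.
by move=> /eqP; rewrite sub0r oppr_eq0.
Qed.

End OneGenerator.

(** The last variable moves into the coefficients, so that an induction over all rings [A] can
    adjoin the generators one at a time. *)
Definition mpoly_unlast n (A : comNzRingType) :
    {rmorphism {mpoly A[n.+1]} -> {mpoly {poly A}[n]}} :=
  mmap (@mpolyC n {poly A} \o polyC)
    (fun i => if unlift ord_max i is Some j then 'X_j else ('X)%:MP).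

Lemma mmap_unlast n (A B : comNzRingType) (f : {rmorphism A -> B})
    (h : 'I_n -> B) c (P : {mpoly A[n.+1]}) :
  mmap (horner_eval c \o map_poly f) h (mpoly_unlast n A P) =
  mmap f (fun i => if unlift ord_max i is Some j then h j else c) P.
Proof.
rewrite [LHS](rmorph_mmap (@mpolyC n {poly A} \o polyC)
  (mmap (horner_eval c \o map_poly f) h)).
apply: eq_mmap => [a|i] /=.
  by rewrite mmapC /= map_polyC horner_evalE hornerC.
case: unliftP => [j _|_]; first by rewrite mmapX mmap1U.
by rewrite mmapC /= map_polyX horner_evalE hornerX.
Qed.

(** Algebraic form of Chevalley's theorem: [phi] extends to the finitely generated extension
    alpha(A)[b] as soon as it does not kill [a]. The induction gives a condition [a'] over A with
    the last generator adjoined, and [specialize1] turns it into a condition over [A]. *)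
Lemma specialize n (A : comNzRingType) (alpha : {rmorphism A -> F})
    (b : 'I_n -> F) (t : {mpoly A[n]}) : mmap alpha b t != 0 ->
  exists2 a : A, alpha a != 0 &
    forall phi : {rmorphism A -> K}, (forall u, alpha u = 0 -> phi u = 0) ->
    phi a != 0 ->
    exists2 v : 'I_n -> K, forall P, mmap alpha b P = 0 -> mmap phi v P = 0
      & mmap phi v t != 0.
Proof.
elim: n A alpha b t => [|n IH] A alpha b t t0.
  exists t@_0%MM; first by move: t0; rewrite [t]nvar0_mpolyC mmapC mcoeffC eqxx mulr1.
  move=> phi ker ta; exists (fun => 0); last by rewrite [t]nvar0_mpolyC mmapC.
  by move=> P; rewrite [P]nvar0_mpolyC !mmapC => /ker.
pose alpha' : {rmorphism {poly A} -> F} :=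
  horner_eval (b ord_max) \o map_poly alpha.
pose b' j := b (lift ord_max j).
have bE P : mmap alpha' b' (mpoly_unlast n A P) = mmap alpha b P.
  rewrite mmap_unlast; apply: eq_mmap => // i.
  by case: unliftP => [j ->|->].
have [|a' a'0 specA] := IH _ alpha' b' (mpoly_unlast n A t); first by rewrite bE.
have [a a0 spec1] := specialize1 a'0; exists a => // phi ker phia.
have [c kerc phic] := spec1 phi ker phia.
pose phi' : {rmorphism {poly A} -> K} := horner_eval c \o map_poly phi.
have [v kerv tv] := specA phi' kerc phic.
exists (fun i => if unlift ord_max i is Some j then v j else c).
  by move=> P P0; rewrite -mmap_unlast kerv // bE.
by rewrite -mmap_unlast.
Qed.

End Specialization.


(** * Affine space *)

Lemma near_openP (T : topologicalType) (x : T) (P : T -> Prop) :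
  (\forall y \near x, P y) <->
  exists O : set T, [/\ open O, O x & forall y, O y -> P y].
Proof.
have -> : (\forall y \near x, P y) = nbhs x P by [].
by rewrite nbhsE; split=> [[O [Oo Ox] OP]|[O [Oo Ox OP]]]; exists O.
Qed.

Section AffineTopology.
Variables (K : numClosedFieldType) (n : nat).
Implicit Types (p q s t : {mpoly K[n]}) (v w : affine K n) (U V : set (affine K n)).

Definition principal_open s : set (affine K n) := [set v | peval s v != 0].

Lemma pevalM p q (v : affine_space K n) : peval (p * q) v = peval p v * peval q v.
Proof. exact: mevalM. Qed.

Lemma pevalD p q (v : affine_space K n) : peval (p + q) v = peval p v + peval q v.
Proof. exact: mevalD. Qed.

Lemma pevalB p q (v : affine_space K n) : peval (p - q) v = peval p v - peval q v.
Proof. exact: mevalB. Qed.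

Lemma peval1 (v : affine_space K n) : peval 1 v = 1.
Proof. exact: meval1. Qed.

Lemma principal_open_open s : open (principal_open s).
Proof.
suff : zariski_open (principal_open s) by [].
exists [set s]; apply/seteqP; split=> v /=.
  by move=> sv /(_ s erefl) sv0; rewrite /principal_open /= sv0 eqxx in sv.
by apply: contra_notN => /eqP sv p ->.
Qed.

Lemma open_affineP U : open U <->
  forall v, U v -> exists2 s, peval s v != 0 & principal_open s `<=` U.
Proof.
split=> [[S ->] v /existsNP[p /not_implyP[Sp /eqP pv]]|UP].
  by exists p => // w /eqP pw /(_ p Sp).
have -> : U = \bigcup_(s in [set s | principal_open s `<=` U]) principal_open s.
  apply/seteqP; split=> [v /UP[s sv sU]|v [s sU sv]]; last exact: sU.
  by exists s.
by apply: bigcup_open => s _; exact: principal_open_open.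
Qed.

Lemma near_affineP v (P : affine K n -> Prop) :
  (\forall w \near v, P w) <->
  exists2 s, peval s v != 0 & forall w, peval s w != 0 -> P w.
Proof.
rewrite near_openP; split=> [[O [/open_affineP Oo /Oo[s sv sO] OP]]|[s sv sP]].
  by exists s => // w /sO/OP.
by exists (principal_open s); split => //; exact: principal_open_open.
Qed.

Lemma peval_nonzero p : p != 0 -> exists v, peval p v != 0.
Proof.
move=> /mpoly_nonzero[v pv]; exists (\row_i v i).
by rewrite /peval (@meval_eq _ _ _ v) // => i; rewrite mxE.
Qed.

Lemma peval_inj_on U p q : open U -> U !=set0 ->
  (forall v, U v -> peval p v = peval q v) -> p = q.
Proof.
move=> /open_affineP Uo [v /Uo[s sv sU]] pq.
apply/eqP; rewrite -subr_eq0; apply: contraT => pq0.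
have s0 : s != 0 by apply: contraNneq sv => ->; rewrite /peval meval0.
have /peval_nonzero[w] : s * (p - q) != 0 by rewrite mulf_neq0.
by rewrite pevalM pevalB mulf_eq0 negb_or => /andP[/sU/pq->]; rewrite subrr eqxx.
Qed.

Lemma affine_irreducible U V : open U -> open V -> U !=set0 -> V !=set0 ->
  U `&` V !=set0.
Proof.
move=> /open_affineP Uo /open_affineP Vo [u /Uo[s su sU]] [v /Vo[t tv tV]].
have s0 : s != 0 by apply: contraNneq su => ->; rewrite /peval meval0.
have t0 : t != 0 by apply: contraNneq tv => ->; rewrite /peval meval0.
have /peval_nonzero[w] : s * t != 0 by rewrite mulf_neq0.
by rewrite pevalM mulf_eq0 negb_or => /andP[/sU Uw /tV Vw]; exists w.
Qed.

Lemma affine_regular_poly p v : regular_at v (fun w : affine K n => peval p w).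
Proof.
exists p, 1; split; first by rewrite peval1 oner_eq0.
by apply/near_openP; exists setT; split => // [|w _]; [exact: openT|rewrite peval1 divr1].
Qed.

Lemma affine_prevariety : prevariety (affine K n).
Proof.
exists 1%N, (fun=> setT); split; first by apply/seteqP; split=> // v _; exists ord0.
move=> _; exists n, id; split => //.
- exact: openT.
- move=> W _; split=> [Wo|[O [Oo ->]]]; first by exists W; rewrite setTI.
  by rewrite setTI.
Qed.

Lemma affine_separated : separated_space (affine K n).
Proof.
move=> x y /= xy.
have [i xyi] : exists i, (x : 'rV[K]_n) 0 i != (y : 'rV[K]_n) 0 i.
  apply: contrapT => /forallNP xyE; apply: xy; apply/rowP => i.
  by have /negP/negPn/eqP := xyE i.
have XE v : peval 'X_i v = (v : 'rV[K]_n) 0 i by rewrite /peval mevalXU.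
(* The function x_i - y_i, written as x_i * 1 + 1 * (- y_i). *)
exists setT, setT, 2%N,
  (fun j v => peval (if j == 0 then 'X_i else 1) v),
  (fun j v => peval (if j == 0 then 1 else - 'X_i) v).
split; [by split => //; exact: openT| | | |].
- by move=> j v _; exact: affine_regular_poly.
- by move=> j v _; exact: affine_regular_poly.
- rewrite big_ord_recl big_ord1 /= !peval1 mulr1 mul1r.
  by rewrite [peval (- _) _]mevalN -![meval _ _]/(peval _ _) !XE subr_eq0.
move=> x' y' _ _; rewrite big_ord_recl big_ord1 /= !peval1 mulr1 mul1r.
rewrite [peval (- _) _]mevalN -![meval _ _]/(peval _ _) !XE subr_eq0.
by move=> + xy' => /eqP; rewrite xy'.
Qed.

Lemma affine_variety : variety (affine K n).
Proof.
split; [exact: affine_prevariety | exact: affine_separated|].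
split; first by exists (0 : 'rV[K]_n).
exact: affine_irreducible.
Qed.

Lemma common_denominator m (f : 'I_m -> affine K n -> K) x :
  (forall i, regular_at x (f i)) ->
  exists (p : 'I_m -> {mpoly K[n]}) q, peval q x != 0 /\
    forall w, peval q w != 0 -> forall i, f i w = peval (p i) w / peval q w.
Proof.
move=> freg.
have /choice[pqs pqsP] i : exists pqs : {mpoly K[n]} * {mpoly K[n]} * {mpoly K[n]},
    [/\ peval pqs.1.2 x != 0, peval pqs.2 x != 0 &
     forall w, peval pqs.2 w != 0 -> f i w = peval pqs.1.1 w / peval pqs.1.2 w].
  have [p [q [qx /near_affineP[s sx fE]]]] := freg i.
  by exists (p, q, s).
(* Besides the denominator, [d i] contains the polynomial cutting out the neighbourhood where [f i]
   is a fraction; the formulas thus hold wherever the product is nonzero. *)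
pose d i : {mpoly K[n]} := (pqs i).1.2 * (pqs i).2.
exists (fun i => (pqs i).1.1 * (pqs i).2 * \prod_(j | j != i) d j), (\prod_i d i).
have pevalP I (r : seq I) (P : pred I) (F : I -> {mpoly K[n]}) w :
    peval (\prod_(i <- r | P i) F i) w = \prod_(i <- r | P i) peval (F i) w.
  exact: rmorph_prod.
split.
  rewrite pevalP; apply/prodf_neq0 => i _.
  rewrite /d pevalM.
  by have [? ? _] := pqsP i; rewrite mulf_neq0.
move=> w; rewrite pevalP => dw i; have [_ _ fE] := pqsP i.
move/prodf_neq0 : (dw) => /(_ i isT); rewrite /d pevalM mulf_eq0 negb_or.
move=> /andP[qw sw]; rewrite fE //.
have -> : \prod_i peval (d i) w =
    peval (d i) w * \prod_(j | j != i) peval (d j) w by rewrite (bigD1 i).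
rewrite !pevalM pevalP.
have d0 : \prod_(j | j != i) peval (d j) w != 0.
  by apply/prodf_neq0 => j _; move/prodf_neq0 : dw => /(_ j isT).
by field; rewrite ?qw ?sw ?d0.
Qed.

Lemma mevalE_homogenize m N (p : 'I_m -> {mpoly K[n]}) q (T : {mpoly K[m]}) w :
  (msize T <= N.+1)%N -> peval q w != 0 ->
  peval (homogenize N p q T) w =
    peval q w ^+ N * T.@[fun i => peval (p i) w / peval q w].
Proof.
move=> TN qw; rewrite [LHS](homogenizeE (e := meval (fun i => w 0 i))) //.
congr (_ * _); apply: eq_mmap => // c /=; exact: mevalC.
Qed.

(** Identity principle: near a point of [U] the expression is a fraction whose numerator vanishes on
    a nonempty open set, hence is 0. *)
Lemma regular_poly_eq0 m (f : 'I_m -> affine K n -> K) U V (T : {mpoly K[m]}) :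
  open V -> V !=set0 -> (forall i, regular_on U (f i)) ->
  (forall v, V v -> T.@[fun i => f i v] = 0) ->
  forall v, U v -> T.@[fun i => f i v] = 0.
Proof.
move=> Vo V0 freg TV v Uv.
have [p [q [qv fE]]] := common_denominator (fun i => freg i v Uv).
have TE w : peval q w != 0 -> peval (homogenize (msize T) p q T) w =
    peval q w ^+ msize T * T.@[fun i => f i w].
  move=> qw; rewrite mevalE_homogenize //; congr (_ * _).
  by apply: meval_eq => i; rewrite fE.
have /peval_inj_on H : open (V `&` principal_open q).
  by apply: openI => //; exact: principal_open_open.
have {}H : homogenize (msize T) p q T = 0.
  apply: H => [|w [Vw qw]].
    by apply: affine_irreducible => //; [exact: principal_open_open|exists v].
  by rewrite TE // TV // mulr0 /peval meval0.
have /eqP := TE _ qv; rewrite H [peval 0 v]meval0 eq_sym mulf_eq0.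
by rewrite expf_eq0 (negbTE qv) andbF => /eqP.
Qed.

End AffineTopology.

(** * Dimension of affine space *)

Section Dimension.
Variables (K : numClosedFieldType) (n : nat).

Lemma msize_prod_le I (r : seq I) (F : I -> {mpoly K[n]}) (d : I -> nat) :
  (forall i, (msize (F i) <= (d i).+1)%N) ->
  (msize (\prod_(i <- r) F i) <= (\sum_(i <- r) d i).+1)%N.
Proof.
move=> Fd; elim/big_rec2: _ => [|i s p _ IH].
  by rewrite -mpolyC1 msizeC oner_eq0.
have [->|F0] := eqVneq (F i) 0; first by rewrite mul0r msize0.
have [->|p0] := eqVneq p 0; first by rewrite mulr0 msize0.
rewrite msizeM //; move: (Fd i) IH => {F0 p0}.
by set a := msize (F i); set b := msize p => ? ? /=; lia.
Qed.

(* There are M ^ e monomials with exponents < M in the e unknowns, and after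
   multiplication by q ^+ N they lie in a space of dimension
   (N * D).+1 ^ n <= (M * (e * D).+1) ^ n, which is smaller for large M. *)
Lemma polynomial_relation e (p : 'I_e -> {mpoly K[n]}) (q : {mpoly K[n]}) :
  (n < e)%N ->
  exists2 T : {mpoly K[e]}, T != 0 & forall w, peval q w != 0 ->
    T.@[fun i => peval (p i) w / peval q w] = 0.
Proof.
move=> ne; pose D := (msize q + \max_i msize (p i))%N.
have qD : (msize q <= D.+1)%N by rewrite /D -addnS leq_addr.
have pD i : (msize (p i) <= D.+1)%N.
  rewrite (leq_trans (leq_bigmax (F := fun i => msize (p i)) i)) //.
  by rewrite /D leqW // leq_addl.
(* With this [M], (M * (e * D).+1) ^ n < M ^ n.+1 <= M ^ e. *)
pose M := ((e * D).+1 ^ n).+1; pose N := (e * M)%N.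
have ltM : ((e * D).+1 ^ n < M)%N by [].
have M0 : (0 < M)%N by [].
pose rowT := {ffun 'I_e -> 'I_M}; pose colT := {ffun 'I_n -> 'I_(N * D).+1}.
have card_lt : (#|colT| < #|rowT|)%N.
  rewrite !card_ffun !card_ord.
  have NM : ((N * D).+1 <= M * (e * D).+1)%N.
    by rewrite /N mulnS -mulnA mulnCA addnC -addn1 leq_add2l.
  apply: (@leq_ltn_trans ((M * (e * D).+1) ^ n)).
    by case: (posnP n) => [->|n0]; rewrite ?expn0 // leq_exp2r.
  rewrite expnMn; apply: (@leq_trans (M ^ n * M)).
    by rewrite ltn_mul2l expn_gt0 M0.
  by rewrite -expnSr leq_pexp2l.
have sum_le (a : rowT) : (\sum_i a i <= N)%N.
  apply: (@leq_trans (\sum_(i < e) M)).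
    by apply: leq_sum => i _; exact: ltnW.
  by rewrite sum_nat_const card_ord.
pose hom (a : rowT) : {mpoly K[n]} := (\prod_i p i ^+ a i) * q ^+ (N - \sum_i a i).
have msize_exp (r : {mpoly K[n]}) k : (msize r <= D.+1)%N ->
    (msize (r ^+ k) <= (k * D).+1)%N.
  move=> rD.
  have -> : r ^+ k = \prod_(0 <= i < k) r by rewrite prodr_const_nat subn0.
  by rewrite (leq_trans (msize_prod_le _ (fun=> rD))) // sum_nat_const_nat subn0.
have size_hom a : (msize (hom a) <= (N * D).+1)%N.
  have [->|h0] := eqVneq (hom a) 0; first by rewrite msize0.
  have := h0; rewrite /hom mulf_eq0 negb_or => /andP[h1 h2].
  rewrite msizeM //.
  have := msize_prod_le (index_enum _) (fun i => msize_exp _ (a i) (pD i)).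
  rewrite -big_distrl /=; have := msize_exp _ (N - \sum_i a i)%N qD.
  have := leq_mul (sum_le a) (leqnn D); rewrite mulnBl.
  set x := msize _; set y := msize _; set u := (_ * D)%N; lia.
pose A : 'M[K]_(#|rowT|, #|colT|) :=
  \matrix_(i, j) (hom (enum_val i))@_[multinom ((enum_val j : colT) k : nat) | k < n].
have : kermx A != 0.
  rewrite kermx_eq0 /row_free; apply: contraTneq card_lt => <-.
  by rewrite -leqNgt rank_leq_col.
move=> /rowV0Pn[c /sub_kermxP cA c0].
have homE : \sum_i c 0 i *: hom (enum_val i) = 0.
  apply/mpolyP => m; rewrite mcoeff0 raddf_sum /=.
  under eq_bigr do rewrite mcoeffZ.
  have [mN|Nm] := leqP (mdeg m) (N * D).
    have mi k : (m k < (N * D).+1)%N.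
      by rewrite ltnS (leq_trans _ mN) // mdegE (bigD1 k) //= leq_addr.
    pose b : colT := [ffun k => Ordinal (mi k)].
    have /rowP/(_ (enum_rank b)) := cA; rewrite !mxE => {2}<-.
    apply: eq_bigr => i _; rewrite mxE enum_rankK; congr (_ * _@__).
    by apply/mnmP => k; rewrite mnmE ffunE.
  apply: big1 => i _; rewrite memN_msupp_eq0 ?mulr0 //.
  by apply: msize_mdeg_ge; rewrite (leq_trans (size_hom _)).
pose mon (a : rowT) : 'X_{1..e} := [multinom (a k : nat) | k < e].
have mon_inj : injective mon.
  move=> a b /mnmP ab; apply/ffunP => k; apply: val_inj.
  by have := ab k; rewrite !mnmE.
exists (\sum_i c 0 i *: 'X_[mon (enum_val i)]).
  apply: contraNneq c0 => T0; apply/eqP/rowP => i; rewrite mxE.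
  have := congr1 (mcoeff (mon (enum_val i))) T0; rewrite mcoeff0 raddf_sum /=.
  rewrite (bigD1 i) //= mcoeffZ mcoeffX eqxx mulr1 big1 ?addr0 // => k ki.
  rewrite mcoeffZ mcoeffX (inj_eq mon_inj) (inj_eq enum_val_inj) (negbTE ki).
  by rewrite mulr0.
move=> w qw; apply: (mulfI (expf_neq0 N qw)); rewrite mulr0 raddf_sum mulr_sumr /=.
have := congr1 (fun r : {mpoly K[n]} => peval r w) homE; rewrite [peval 0 w]meval0 => {2}<-.
rewrite [RHS]raddf_sum; apply: eq_bigr => i _ /=.
rewrite [RHS]mevalZ mevalZ mulrCA; congr (_ * _); rewrite mevalX.
rewrite [RHS]pevalM [peval (_ ^+ _) _]rmorphXn [peval (\prod_(_ < _) _) _]rmorph_prod /=.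
rewrite -[in peval q w ^+ N](subnKC (sum_le (enum_val i))) exprD mulrAC; congr (_ * _).
rewrite -prodrXr -big_split /=; apply: eq_bigr => k _.
by rewrite mnmE -exprMn mulrC divfK // rmorphXn.
Qed.

Lemma affine_dimension : dimension (affine K n) n.
Proof.
split.
  exists setT, (fun i => peval 'X_i); split => //; first exact: openT.
  - by exists (0 : 'rV[K]_n).
  - by move=> i v _; exact: affine_regular_poly.
  move=> p p0; apply: (@peval_inj_on _ _ setT) => [| |v _]; first exact: openT.
    by exists (0 : 'rV[K]_n).
  rewrite [RHS]meval0 -(p0 v I); apply: meval_eq => i.
  by rewrite /peval mevalXU.
move=> e [U [f [Uo [x Ux] freg indep]]]; rewrite leqNgt; apply/negP => ne.
have [p [q [qx fE]]] := common_denominator (fun i => freg i x Ux).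
have [T T0 Tq] := polynomial_relation p q ne.
move/eqP: T0; apply; apply: indep.
apply: (regular_poly_eq0 (principal_open_open q)) => //; first by exists x.
by move=> v qv; rewrite -[RHS](Tq v qv); apply: meval_eq => i; rewrite fE.
Qed.

End Dimension.


(** * Regular functions and dominant maps *)

Section RegularFunctions.
Variables (K : numClosedFieldType) (X : Defs.space K).

Lemma chart_preimage_open (U : set X) n (phi : X -> affine K n) O :
  affine_chart U phi -> open O -> open (U `&` phi @^-1` O).
Proof.
case=> _ _ _ topo _ Oo.
by apply/(topo _ (@subIsetl _ _ _)); exists O.
Qed.

Lemma chart_near (U : set X) n (phi : X -> affine K n) s x :
  affine_chart U phi -> U x -> peval s (phi x) != 0 ->
  \forall y \near x, U y /\ peval s (phi y) != 0.
Proof.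
move=> Uphi Ux sx; apply/near_openP.
by exists (U `&` phi @^-1` principal_open s); split => //;
   apply: chart_preimage_open => //; exact: principal_open_open.
Qed.

Lemma chart_regular_poly (U : set X) n (phi : X -> affine K n) p x :
  affine_chart U phi -> U x -> regular_at x (fun y => peval p (phi y)).
Proof.
case=> _ _ _ _ reg Ux; apply/reg => //; exists p, 1.
rewrite peval1 oner_eq0; split => //.
by apply: nearW => y; rewrite peval1 divr1.
Qed.

Hypothesis preX : prevariety X.

Lemma chart_at (x : X) :
  exists U n (phi : X -> affine K n), affine_chart U phi /\ U x.
Proof.
have [m [U [cover charts]]] := preX.
have [i _ Uix] : (\bigcup_i U i) x by rewrite cover.
by have [n [phi Uphi]] := charts i; exists (U i), n, phi.
Qed.

(** A [space] carries no axioms on [regular_at]; the sheaf properties are read off from the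
    charts. *)
Lemma regular_at_germ (x : X) (f g : X -> K) :
  (\forall y \near x, f y = g y) -> regular_at x f -> regular_at x g.
Proof.
have [U [n [phi [Uphi Ux]]]] := chart_at x.
have [_ _ _ _ reg] := Uphi; move=> fg /reg[]// p [q [qx fE]].
apply/reg => //; exists p, q; split => //.
by apply: filterS2 fg fE => y <-.
Qed.

Lemma regular_at_cst (x : X) (c : K) : regular_at x (fun=> c).
Proof.
have [U [n [phi [Uphi Ux]]]] := chart_at x.
apply: regular_at_germ (chart_regular_poly c%:MP Uphi Ux).
by apply: nearW => y; rewrite /peval mevalC.
Qed.

Lemma regular_at_neq0 (x : X) (f : X -> K) :
  regular_at x f -> f x != 0 -> \forall y \near x, f y != 0.
Proof.
have [U [n [phi [Uphi Ux]]]] := chart_at x.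
have [_ _ _ _ reg] := Uphi; move=> /reg[]// p [q [qx fE]].
rewrite (nbhs_singleton fE) mulf_eq0 invr_eq0 negb_or => /andP[px _].
apply: filterS3 fE (chart_near Uphi Ux px) (chart_near Uphi Ux qx).
by move=> y -> [_ py] [_ qy]; rewrite mulf_neq0 ?invr_eq0.
Qed.

Lemma regular_atD (x : X) (f g : X -> K) :
  regular_at x f -> regular_at x g -> regular_at x (fun y => f y + g y).
Proof.
have [U [n [phi [Uphi Ux]]]] := chart_at x.
have [_ _ _ _ reg] := Uphi.
move=> /reg[]// p [q [qx fE]] /reg[]// p' [q' [qx' gE]].
apply/reg => //; exists (p * q' + p' * q), (q * q').
rewrite pevalM mulf_neq0 //; split => //.
near=> y; have -> : f y = peval p (phi y) / peval q (phi y) by near: y.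
have -> : g y = peval p' (phi y) / peval q' (phi y) by near: y.
have qy : peval q (phi y) != 0.
  by near: y; apply: filterS (chart_near Uphi Ux qx) => y [].
have qy' : peval q' (phi y) != 0.
  by near: y; apply: filterS (chart_near Uphi Ux qx') => y [].
by rewrite !(pevalM, pevalD); field; rewrite qy qy'.
Unshelve. all: by end_near. Qed.

Lemma regular_atM (x : X) (f g : X -> K) :
  regular_at x f -> regular_at x g -> regular_at x (fun y => f y * g y).
Proof.
have [U [n [phi [Uphi Ux]]]] := chart_at x.
have [_ _ _ _ reg] := Uphi.
move=> /reg[]// p [q [qx fE]] /reg[]// p' [q' [qx' gE]].
apply/reg => //; exists (p * p'), (q * q').
rewrite pevalM mulf_neq0 //; split => //.
by apply: filterS2 fE gE => y -> ->; rewrite !pevalM mulf_div.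
Qed.

Lemma regular_at_sum (x : X) I (r : seq I) (f : I -> X -> K) :
  (forall i, regular_at x (f i)) -> regular_at x (fun y => \sum_(i <- r) f i y).
Proof.
move=> freg; elim: r => [|i r IH].
  apply: regular_at_germ (regular_at_cst x 0).
  by apply: nearW => y; rewrite big_nil.
apply: regular_at_germ (regular_atD (freg i) IH).
by apply: nearW => y; rewrite big_cons.
Qed.

Lemma regular_open_neq0 (U : set X) (f : X -> K) :
  open U -> regular_on U f -> open (U `&` [set x | f x != 0]).
Proof.
move=> Uo freg; rewrite openE => x [Ux fx].
apply: filterI; first exact: open_nbhs_nbhs.
exact: regular_at_neq0 (freg x Ux) fx.
Qed.

End RegularFunctions.

Section Morphisms.
Variable K : numClosedFieldType.
Implicit Types X Y Z : Defs.space K.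

Lemma morphism_on_comp X Y Z (U : set X) (V : set Y) (f : X -> Y) (g : Y -> Z) :
  morphism_on U f -> morphism_on V g -> (forall x, U x -> V (f x)) ->
  morphism_on U (g \o f).
Proof.
move=> mf mg UV x Ux; have [fc fr] := mf x Ux; have [gc gr] := mg _ (UV x Ux).
by split=> [|h /gr/fr//]; apply: continuous_comp.
Qed.

Lemma morphism_on_sub X Y (U V : set X) (f : X -> Y) :
  U `<=` V -> morphism_on V f -> morphism_on U f.
Proof. by move=> UV mf x /UV/mf. Qed.

Lemma morphism_preimage_open X Y (U : set X) (f : X -> Y) (O : set Y) :
  morphism_on U f -> open U -> open O -> open (U `&` f @^-1` O).
Proof.
move=> mf Uo Oo; rewrite openE => x [Ux Ofx].
apply: filterI; first exact: open_nbhs_nbhs.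
have [fc _] := mf x Ux; apply: (fc O); exact: open_nbhs_nbhs.
Qed.

(** [prod_open] is finer than the product topology, so continuity of (f, g) is not enough. The
    function sum_i a_i(x) b_i(y) given by separatedness pulls back to a regular function on [X], and
    its nonvanishing is an open condition. *)
Lemma neq_locus_open X Y (f g : X -> Y) : prevariety X -> separated_space Y ->
  morphism_on setT f -> morphism_on setT g -> open [set x | f x <> g x].
Proof.
move=> preX sepY mf mg; rewrite openE => x /= fgx.
have [U [V [m [a [b [[Uo Vo Ux Vx] areg breg ab0 abP]]]]]] := sepY _ _ fgx.
have [fc fr] := mf x I; have [gc gr] := mg x I.
have hreg : regular_at x (fun y => \sum_i a i (f y) * b i (g y)).
  apply: regular_at_sum => // i; apply: regular_atM => //.
    by apply: fr; exact: areg.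
  by apply: gr; exact: breg.
have fU : \forall y \near x, U (f y) by apply: fc; exact: open_nbhs_nbhs.
have gV : \forall y \near x, V (g y) by apply: gc; exact: open_nbhs_nbhs.
have h0 := regular_at_neq0 preX hreg ab0.
by apply: filterS3 fU gV h0 => y Uy Vy; exact: abP.
Qed.

Definition polynomial_map m n (P : 'I_n -> {mpoly K[m]}) (v : affine K m) :
  affine K n := (\row_i peval (P i) v : 'rV[K]_n).

Lemma peval_polynomial_map m n (P : 'I_n -> {mpoly K[m]}) (s : {mpoly K[n]}) v :
  peval s (polynomial_map P v) = peval (mmap (@mpolyC m K) P s) v.
Proof.
rewrite /peval [RHS](rmorph_mmap _ (meval (fun i => (v : 'rV[K]_m) 0 i))).
by apply: eq_mmap => [c|i] /=; rewrite ?mevalC // mxE.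
Qed.

Lemma polynomial_map_morphism m n (P : 'I_n -> {mpoly K[m]}) :
  morphism_on setT (polynomial_map P).
Proof.
move=> v _.
have cont : {for v, continuous (polynomial_map P)}.
  move=> O /near_affineP[s sv sO].
  apply/near_affineP; exists (mmap (@mpolyC m K) P s).
    by rewrite -peval_polynomial_map.
  by move=> w; rewrite -peval_polynomial_map => /sO.
split=> // g [p [q [qv gE]]].
exists (mmap (@mpolyC m K) P p), (mmap (@mpolyC m K) P q).
rewrite -peval_polynomial_map; split=> //.
have : \forall w \near v, _ := cont _ gE; apply: filterS => w /= ->.
by rewrite -!peval_polynomial_map.
Qed.

End Morphisms.

(** * Chevalley's theorem and rational connectedness for dominant maps from affine space *)

Section DominantMaps.
Variables (K : numClosedFieldType) (X : Defs.space K) (n : nat).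
Hypothesis varX : variety X.
Variable f : ratmap (affine K n) X.
Hypothesis domf : dominant f.

Let preX : prevariety X. Proof. by case: varX. Qed.

Lemma dominant_meets (O : set X) (V : set (affine K n)) :
  open O -> O !=set0 -> open V -> V !=set0 ->
  exists v, [/\ V v, rdom f v & O (f v)].
Proof.
move=> Oo O0 Vo V0; have [x [Ox [v fv vx]]] := domf O0 Oo.
have [|w [Vw [fw Ow]]] := affine_irreducible Vo
  (morphism_preimage_open (@rfun_morphism _ _ _ f) (rdom_open f) Oo) V0.
  by exists v; split => //=; rewrite vx.
by exists w.
Qed.

(** In a chart, [f] is given by fractions p_i / q, that is, by a homomorphism [alpha] from K[y] to
    the fraction field of K[x]. A point z of the chart is a homomorphism K[y] -> K killing ker
    alpha; extending it to the coordinates x gives a preimage of z. *)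
Lemma dominant_image_open :
  exists O : set X, [/\ open O, O !=set0 & O `<=` f @` rdom f].
Proof.
have [v0 fv0] := rdom_neq0 f.
have [U [m [phi [Uphi Ux]]]] := chart_at preX (f v0).
have [Uo phi_inj _ topo reg] := Uphi.
pose y i v := (phi (f v) : 'rV[K]_m) 0 i.
have phiE i v : y i v = peval 'X_i (phi (f v)) by rewrite /peval mevalXU.
have [_ fr] := rfun_morphism fv0.
have yreg i : regular_at v0 (y i).
  have -> : y i = (fun z => peval 'X_i (phi z)) \o f by apply/funext => v; exact: phiE.
  by apply: fr; exact: (chart_regular_poly 'X_i Uphi).
have [p [q [qv yE]]] := common_denominator yreg.
have Wo := morphism_preimage_open (@rfun_morphism _ _ _ f) (rdom_open f) Uo.
have /open_affineP/(_ v0)[//|s sv sW] := Wo.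
(* Where [t] is nonzero, [f] is defined with values in the chart, and its coordinates are the
   fractions p_i / q. *)
pose t := s * q.
have t_sq v : peval t v != 0 -> peval s v != 0 /\ peval q v != 0.
  by rewrite pevalM mulf_eq0 negb_or => /andP[].
have tv0 : peval t v0 != 0 by rewrite pevalM mulf_neq0.
have q0 : q != 0 by apply: contraNneq qv => ->; rewrite [peval _ _]meval0.
have t0 : t != 0 by apply: contraNneq tv0 => ->; rewrite [peval _ _]meval0.
pose F := {fraction {mpoly K[n]}}.
pose emb : {rmorphism {mpoly K[n]} -> F} := @tofrac {mpoly K[n]}.
pose yF i : F := emb (p i) / emb q.
pose alpha : {rmorphism {mpoly K[m]} -> F} := mmap (emb \o @mpolyC n K) yF.
have alphaX i : alpha 'X_i = emb (p i) / emb q by rewrite /alpha /= mmapX mmap1U.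
have embq0 : emb q != 0 by rewrite /emb /= tofrac_eq0.
(* The kernel of [alpha] is the ideal of the image of the locus where [t] is nonzero. *)
have alphaE (T : {mpoly K[m]}) : alpha T = 0 <->
    forall v, peval t v != 0 -> peval T (phi (f v)) = 0.
  have valE v : peval t v != 0 -> peval (homogenize (msize T) p q T) v =
      peval q v ^+ msize T * peval T (phi (f v)).
    move=> /t_sq[_ qv']; rewrite mevalE_homogenize //; congr (_ * _).
    by apply: meval_eq => i; rewrite -yE.
  have E : emb (homogenize (msize T) p q T) = emb q ^+ msize T * alpha T.
    exact: homogenizeE.
  split=> [T0 v tv|T0].
    have H0 : homogenize (msize T) p q T = 0.
      by apply/eqP; rewrite -(tofrac_eq0 (R := {mpoly K[n]})) -/emb [tofrac _]E T0 mulr0.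
    have /eqP := valE v tv; rewrite H0 [peval 0 v]meval0 eq_sym mulf_eq0.
    by rewrite expf_eq0 (negbTE (t_sq v tv).2) andbF => /eqP.
  have H0 : homogenize (msize T) p q T = 0.
    apply: (peval_inj_on (principal_open_open t)) => [|v tv]; first by exists v0.
    by rewrite valE // T0 // mulr0 [peval 0 v]meval0.
  move/eqP: E; rewrite H0 rmorph0 eq_sym mulf_eq0 expf_eq0 (negbTE embq0) andbF.
  by move/eqP.
pose x i : F := emb 'X_i.
have xC T : mmap alpha x T%:MP = alpha T by exact: mmapC.
have xE (r : {mpoly K[n]}) : mmap alpha x (map_mpoly (@mpolyC m K) r) = emb r.
  apply: (mpoly_rmorph_eq
    (g1 := mmap alpha x \o map_mpoly (@mpolyC m K)) (g2 := emb)) => [c|i] /=.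
    by rewrite map_mpolyC mmapC /= mmapC.
  by rewrite map_mpolyX mmapX mmap1U.
have [|a a0 spec] := specialize K (t := map_mpoly (@mpolyC m K) t)
   (alpha := alpha) (b := x).
  by rewrite xE /emb /= tofrac_eq0.
exists (U `&` phi @^-1` principal_open a); split.
- by apply: chart_preimage_open => //; exact: principal_open_open.
- apply: contrapT => noO; move/eqP: a0; apply; apply/alphaE => v tv.
  apply/eqP; apply: contraT => av; case: noO; exists (f v); split => //.
  by have [/sW[]] := t_sq v tv.
move=> z [Uz az].
pose phiz : {rmorphism {mpoly K[m]} -> K} := meval (fun i => (phi z : 'rV[K]_m) 0 i).
(* If some T in ker alpha were nonzero at z, dominance would give a point of the locus of [t] whose
   image satisfies T <> 0. *)
have [|//|v kerv tv] := spec phiz.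
  move=> T /alphaE T0; apply/eqP; apply: contraT => Tz.
  have [||w [/T0 Tw fw [_ /= ]]] := dominant_meets
    (chart_preimage_open Uphi (principal_open_open T)) _ (principal_open_open t).
  - by exists z.
  - by exists v0.
  by rewrite /principal_open /= Tw eqxx.
pose w : affine K n := (\row_i v i : 'rV[K]_n).
have wE (r : {mpoly K[n]}) : mmap phiz v (map_mpoly (@mpolyC m K) r) = peval r w.
  apply: (mpoly_rmorph_eq (g1 := mmap phiz v \o map_mpoly (@mpolyC m K))
    (g2 := meval (fun i => (w : 'rV[K]_n) 0 i))) => [c|i] /=.
    by rewrite map_mpolyC mmapC /= /phiz !mevalC.
  by rewrite map_mpolyX mmapX mmap1U mevalXU mxE.
have {}tv : peval t w != 0 by rewrite -wE.
have [/sW[fw Uw] qw] := t_sq w tv.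
exists w => //; apply: phi_inj; rewrite ?inE //.
apply/rowP => i; rewrite [LHS]yE //.
(* The relation p_i = y_i q holds in the fraction field, so it is preserved by the specialization:
   [f w] and z have the same coordinates. *)
have : mmap phiz v (map_mpoly (@mpolyC m K) (p i)
    - ('X_i)%:MP * map_mpoly (@mpolyC m K) q) = 0.
  apply: kerv; apply: (eq_trans (rmorphB _ _ _)).
  apply/eqP; rewrite subr_eq0; apply/eqP.
  apply: (eq_trans (xE (p i))); apply: esym.
  apply: (eq_trans (rmorphM _ _ _)).
  apply: (eq_trans (congr2 *%R (xC 'X_i) (xE q))).
  apply: (eq_trans (congr1 ( *%R^~ (emb q)) (alphaX i))).
  exact: (divfK embq0).
move=> /(eq_trans (esym (rmorphB _ _ _)))/eqP; rewrite subr_eq0 => /eqP rel.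
have phizX : mmap phiz v ('X_i)%:MP = (phi z : 'rV[K]_m) 0 i.
  by rewrite mmapC /phiz /= mevalXU.
have -> : peval (p i) w = (phi z : 'rV[K]_m) 0 i * peval q w.
  apply: (eq_trans (esym (wE (p i)))); apply: (eq_trans rel).
  by apply: (eq_trans (rmorphM _ _ _)); apply: (congr2 *%R phizX (wE q)).
by rewrite mulfK.
Qed.

Lemma dominant_rationally_connected : rationally_connected X.
Proof.
have [O [Oo [x0 Ox0] Of]] := dominant_image_open.
exists (O `*` O); split; last 2 first.
- by exists (x0, x0).
- move=> x y [/= /Of[v fv vx] /Of[w fw wy]].
  pose line := polynomial_map (fun i : 'I_n =>
    ((v : 'rV[K]_n) 0 i)%:MP +
    ((w : 'rV[K]_n) 0 i - (v : 'rV[K]_n) 0 i)%:MP * 'X_(ord0 : 'I_1)).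
  pose pt c : affine K 1 := (const_mx c : 'rV[K]_1).
  have lineE c : line (pt c) = (v : 'rV[K]_n) + c *: ((w : 'rV[K]_n) - v).
    apply/rowP => i; rewrite !mxE pevalD pevalM /peval !mevalC mevalXU !mxE.
    by rewrite mulrC.
  have line0 : line (pt 0) = v by rewrite lineE scale0r addr0.
  have line1 : line (pt 1) = w by rewrite lineE scale1r addrC subrK.
  have ml : morphism_on setT line := polynomial_map_morphism _.
  have Do := morphism_preimage_open ml openT (rdom_open f).
  have D0 : [set: affine K 1] `&` line @^-1` rdom f !=set0.
    by exists (pt 0); split => //=; rewrite line0.
  have mc : morphism_on ([set: affine K 1] `&` line @^-1` rdom f) (f \o line).
    apply: morphism_on_comp (@rfun_morphism _ _ _ f) _ => [|u []//].
    by apply: morphism_on_sub ml.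
  exists (RatMap Do D0 mc); split.
    by exists (pt 0) => //=; [split|]; rewrite //= line0.
  by exists (pt 1) => //=; [split|]; rewrite //= line1.
move=> x y [/= Ox Oy]; exists O, O, 1%N, (fun _ _ => 1), (fun _ _ => 1).
split => //.
- by move=> i z _; exact: regular_at_cst.
- by move=> i z _; exact: regular_at_cst.
- by rewrite big_ord1 mulr1 oner_eq0.
Qed.

End DominantMaps.


(** * Actions on varieties *)

Section IrreducibleSpace.
Variables (K : numClosedFieldType) (X : Defs.space K).
Hypothesis irrX : irreducible_space X.

Lemma irreducible_bigI (I : eqType) (s : seq I) (O : I -> set X) :
  (forall i, i \in s -> open (O i) /\ O i !=set0) ->
  open [set x | forall i, i \in s -> O i x] /\
  [set x | forall i, i \in s -> O i x] !=set0.
Proof.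
case: irrX => -[x0 _] irr; elim: s => [|i s IH] Os.
  rewrite (_ : [set _ | _] = setT); first by split; [exact: openT|exists x0].
  by apply/seteqP; split.
have [|Io I0] := IH; first by move=> j js; apply: Os; rewrite inE js orbT.
have [Oo O0] := Os i (mem_head _ _).
rewrite (_ : [set _ | _] = O i `&` [set x | forall j, j \in s -> O j x]).
  by split; [exact: openI|exact: irr].
apply/seteqP; split=> x /= => [Ox|[Ox Osx] j].
  by split=> [|j js]; apply: Ox; rewrite inE ?eqxx // js orbT.
by rewrite inE => /predU1P[->|/Osx].
Qed.

End IrreducibleSpace.

Section PartialActions.
Variables (aT : finGroupType) (D : {group aT}) (rT : Type) (to : action D rT).

Lemma action_mul x a b : a \in D -> b \in D -> to x (a * b)%g = to (to x a) b.
Proof. by case: to => f [_ fM] /= Da Db; apply: fM. Qed.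

Lemma action_one x : to x 1%g = x.
Proof.
have to_inj : injective (to^~ 1%g) by case: to => f [finj _] /=; apply: finj.
by apply: to_inj; rewrite -action_mul // mulg1.
Qed.

Lemma actionK x a : a \in D -> to (to x a) a^-1%g = x.
Proof. by move=> Da; rewrite -action_mul ?groupV // mulgV action_one. Qed.

Lemma actionVK x a : a \in D -> to (to x a^-1%g) a = x.
Proof. by move=> Da; rewrite -action_mul ?groupV // mulVg action_one. Qed.

End PartialActions.

Section FaithfulActions.
Variables (K : numClosedFieldType) (X : Defs.space K).
Hypothesis varX : variety X.
Variables (gT : finGroupType) (G : {group gT}) (to : action G X).
Hypotheses (reg_to : regular_action to) (ff_to : faithful_action to).

Let preX : prevariety X. Proof. by case: varX. Qed.
Let sepX : separated_space X. Proof. by case: varX. Qed.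
Let irrX : irreducible_space X. Proof. by case: varX. Qed.

Lemma moved_locus_open g : g \in G -> open [set x | to x g <> x].
Proof.
move=> Gg; apply: (neq_locus_open (f := to^~ g) (g := id)) => //.
- exact: reg_to.
- by move=> x _; split => // V.
Qed.

Lemma faithful_action_Bir : exists rho : gT -> ratmap X X, Bir_embedding G rho.
Proof.
(* The inverse turns the right action into a homomorphism for composition. Outside [G] the identity
   is a default value, as [rho] is defined on all of [gT]. *)
pose to' g x := if g \in G then to x g^-1%g else x.
have mor g : morphism_on [set: X] (to' g).
  rewrite /to'; case Gg: (g \in G); first by apply: reg_to; rewrite groupV.
  by move=> x _; split => // V.
have X0 : [set: X] !=set0 by case: irrX.
pose rho g := RatMap openT X0 (mor g).
have gen (P : set X) : (forall x, P x) -> generically P.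
  by move=> PT; exists setT; split => //; exact: openT.
have rhoE g x : g \in G -> rho g x = to x g^-1%g by move=> Gg; rewrite /= /to' Gg.
exists rho; split.
- move=> g Gg; exists (rho g^-1%g); split; apply: gen => x; split => //.
    by rewrite !rhoE ?groupV // invgK actionVK.
  by rewrite !rhoE ?groupV // invgK actionK.
- move=> g h Gg Gh; apply: gen => x; split => //.
  by rewrite !rhoE ?groupM // invMg action_mul ?groupV.
move=> g h Gg Gh [W [Wo [w Ww] WE]].
have Ggh : (g^-1 * h)%g \in G by rewrite groupM ?groupV.
suff : (g^-1 * h)%g = 1%g by move/eqP; rewrite -eq_invg_mul invgK => /eqP.
(* A moved point would make the open moved locus nonempty, so it would meet the open set [W] on
   which the two maps agree. *)
apply: ff_to => // x; apply: contrapT => xgh.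
have [_ irr] := irrX.
have [||u [/WE[_ _ ] + uM]] := irr _ _ Wo (moved_locus_open Ggh).
- by exists w.
- by exists x.
rewrite !rhoE // => E; apply: uM.
by rewrite action_mul ?groupV // E actionVK.
Qed.

(** A whole free orbit in one chart can be separated by polynomials in the chart coordinates. Each
    translate of the chart and each locus moved by some g <> 1 is open and nonempty, and finitely
    many of these meet because [X] is irreducible. *)
Lemma free_orbit_in_chart :
  exists (U : set X) n (phi : X -> affine K n) x,
    [/\ affine_chart U phi, forall g, g \in G -> U (to x g),
        forall g, g \in G -> to x g = x -> g = 1%g,
        open [set y | forall g, g \in G -> U (to y g)]
      & [set y | forall g, g \in G -> U (to y g)] !=set0].
Proof.
have [[x0 _] irr] := irrX.
have [U [n [phi [Uphi Ux0]]]] := chart_at preX x0.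
have Uo : open U by case: Uphi.
have pre_open g : g \in enum G -> open (to^~ g @^-1` U) /\ (to^~ g @^-1` U) !=set0.
  rewrite mem_enum => Gg; split; last first.
    by exists (to x0 g^-1%g); rewrite /= actionVK.
  by rewrite -[_ @^-1` _]setTI; apply: morphism_preimage_open => //;
     [exact: reg_to|exact: openT].
have free_open g : g \in [seq g <- enum G | g != 1%g] ->
    open [set x | to x g <> x] /\ [set x | to x g <> x] !=set0.
  rewrite mem_filter mem_enum => /andP[g1 Gg]; split; first exact: moved_locus_open.
  apply: contrapT => noX; move/eqP: g1; apply; apply: ff_to => // x.
  by apply: contrapT => xg; apply: noX; exists x.
have [VO V0] := irreducible_bigI irrX pre_open.
have [FO F0] := irreducible_bigI irrX free_open.
have [x [Vx Fx]] := irr _ _ VO FO V0 F0.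
have VE : [set y | forall g, g \in G -> U (to y g)] =
  [set y | forall g, g \in enum G -> (to^~ g @^-1` U) y].
  by apply/seteqP; split=> y /= Uy g; have := Uy g; rewrite mem_enum.
exists U, n, phi, x; split; rewrite ?VE //.
  by move=> g Gg; apply: (Vx g); rewrite mem_enum.
move=> g Gg xg; apply/eqP; apply: contrapT => /negP g1.
by apply: (Fx g) => //; rewrite mem_filter mem_enum g1.
Qed.

End FaithfulActions.

Lemma separating_polynomial (K : numClosedFieldType) n (v : affine K n)
    (s : seq (affine K n)) :
  v \notin s -> exists2 P : {mpoly K[n]}, peval P v = 1 &
    forall w, w \in s -> peval P w = 0.
Proof.
elim: s => [_|w s IH]; first by exists 1; rewrite ?peval1.
rewrite inE negb_or => /andP[vw /IH[P Pv Ps]].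
have [i vwi] : exists i, (v : 'rV[K]_n) 0 i != (w : 'rV[K]_n) 0 i.
  apply: contrapT => /forallNP vwE; move/eqP: vw; apply; apply/rowP => i.
  by have /negP/negPn/eqP := vwE i.
pose c := (v : 'rV[K]_n) 0 i - (w : 'rV[K]_n) 0 i.
pose L : {mpoly K[n]} := c^-1%:MP * ('X_i - ((w : 'rV[K]_n) 0 i)%:MP).
have LE u : peval L u = c^-1 * ((u : 'rV[K]_n) 0 i - (w : 'rV[K]_n) 0 i).
  by rewrite pevalM pevalB /peval !mevalC mevalXU.
exists (L * P); first by rewrite pevalM LE Pv mulr1 mulVf // subr_eq0.
move=> u; rewrite inE pevalM => /predU1P[->|/Ps->]; last by rewrite mulr0.
by rewrite LE subrr mulr0 mul0r.
Qed.

Section SemiInvariants.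
Variables (K : numClosedFieldType) (X : Defs.space K).
Hypothesis varX : variety X.
Variables (gT : finGroupType) (G : {group gT}) (to : action G X).
Hypotheses (reg_to : regular_action to) (ff_to : faithful_action to).

Lemma semi_invariants (T : Type) (theta : T -> gT -> K) :
  (forall i, {in G &, {morph theta i : g h / (g * h)%g >-> g * h}}) ->
  (forall i, {in G, forall g, theta i g != 0}) ->
  exists (U : set X) (phi : T -> X -> K),
  [/\ open U, forall i, regular_on U (phi i),
      forall i x g, g \in G -> U x -> U (to x g) /\ phi i (to x g) = theta i g * phi i x
    & exists2 x, U x & forall i, phi i x = 1].
Proof.
move=> thetaM theta0.
have theta1 i : theta i 1%g = 1.
  apply: (mulfI (theta0 i _ (group1 G))).
  by rewrite mulr1 -thetaM ?mulg1.
have [C [n [chart [x [Cchart Cx freex Uo _]]]]] :=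
  free_orbit_in_chart varX reg_to ff_to.
have chart_inj : {in C &, injective chart} by case: Cchart.
have preX : prevariety X by case: varX.
set U := [set _ | _] in Uo.
have [|P Px P0] := @separating_polynomial K n (chart x)
   [seq chart (to x g) | g <- [seq g <- enum G | g != 1%g]].
  apply/mapP => -[g]; rewrite mem_filter mem_enum => /andP[g1 Gg].
  have Cx1 : C x by have := Cx _ (group1 G); rewrite action_one.
  move=> /chart_inj; rewrite !inE => /(_ Cx1 (Cx g Gg))/esym.
  by move/freex => /(_ Gg)/eqP; rewrite (negbTE g1).
(* Up to the factor #|G|, the projection of [P \o chart] to the weight [theta i]. At [x] only the
   term g = 1 survives, so all [phi i] take the value 1 there. *)
pose phi i y := \sum_(g in G) (theta i g)^-1 * peval P (chart (to y g)).
exists U, phi; split=> //.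
- move=> i y Uy; rewrite /phi.
  suff reg g : regular_at y (fun z => if g \in G then
      (theta i g)^-1 * peval P (chart (to z g)) else 0).
    have := regular_at_sum preX (enum gT) reg; congr regular_at.
    by apply/funext => z; rewrite big_enum /= [RHS]big_mkcond.
  case Gg: (g \in G); last exact: regular_at_cst.
  apply: regular_atM => //; first exact: regular_at_cst.
  have [_ pull] := reg_to Gg (I : [set: X] y).
  apply: (pull (fun z => peval P (chart z))).
  by apply: (chart_regular_poly _ Cchart); exact: Uy.
- move=> i y g Gg Uy; split=> [h Gh|].
    by rewrite -action_mul //; apply: Uy; rewrite groupM.
  rewrite /phi mulr_sumr (reindex_inj (mulgI g^-1%g)) /=.
  apply: eq_big => h; first by rewrite groupMl ?groupV.
  rewrite groupMl ?groupV // => Gh.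
  rewrite -action_mul ?groupM ?groupV // mulKVg thetaM ?groupV // invfM mulrA.
  congr (_ * _ * _); apply: (mulfI (theta0 i _ (groupVr Gg))).
  by rewrite divff ?theta0 ?groupV // -thetaM ?groupV // mulVg theta1.
exists x => // i; rewrite /phi (bigD1 1%g) //= action_one Px theta1 invr1 mulr1.
rewrite big1 ?addr0 // => g /andP[Gg g1].
rewrite P0 ?mulr0 //; apply/mapP; exists g => //.
by rewrite mem_filter mem_enum g1.
Qed.

End SemiInvariants.


(** * Characters of abelian groups *)

Lemma exists_primitive_root (K : numClosedFieldType) n :
  (0 < n)%N -> exists z : K, n.-primitive_root z.
Proof.
move=> n_gt0; pose p : {poly K} := 'X^n - 1.
have [r Dp] := closed_field_poly_normal p.
have sz_p : size p = n.+1 by rewrite size_XnsubC.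
have pn0 : p != 0 by rewrite -size_poly_gt0 sz_p.
have mon_p : lead_coef p = 1 by rewrite lead_coefXnsubC.
rewrite mon_p scale1r in Dp.
have sz_r : size r = n.
  by have := size_prod_XsubC r id; rewrite -Dp sz_p => -[].
have rn1 : all n.-unity_root r.
  by apply/allP => z; rewrite -root_prod_XsubC -Dp unity_rootE /root !hornerE subr_eq0.
have Ur : uniq r.
  rewrite -separable_prod_XsubC -Dp separable_Xn_sub_1 //.
  by rewrite pnatr_eq0 -lt0n.
have /hasP[z _ prim_z] : has n.-primitive_root r by rewrite has_prim_root ?sz_r.
by exists z.
Qed.

Section Characters.
Variables (K : numClosedFieldType) (gT : finGroupType).
Local Open Scope group_scope.

Lemma cycle_character (x : gT) (z : K) : (#[x]).-primitive_root z ->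
  exists chi : gT -> K, forall k, chi (x ^+ k) = (z ^+ k)%R.
Proof.
move=> prim_z.
exists (fun y => if [pick k : 'I_#[x] | x ^+ k == y] is Some k then (z ^+ k)%R else 1%R).
move=> k; case: pickP => [i /eqP xik|/(_ (Ordinal (ltn_pmod k (order_gt0 x))))].
  by apply/eqP; rewrite (eq_prim_root_expr prim_z) -eq_expg_mod_order xik.
by rewrite /= expg_mod_order eqxx.
Qed.

Lemma dprod_cycles_mem (b : seq gT) (B : {group gT}) x :
  \big[dprod/1]_(y <- b) <[y]> = B -> x \in b -> x \in B.
Proof.
elim: b B => // y b IH B; rewrite big_cons inE => /dprodP[[Y B' _ defB'] defB _ _].
rewrite -defB defB' => /predU1P[->|/(IH B' defB')].
  by apply/mulsgP; exists y 1; rewrite ?cycle_id ?mulg1.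
by move=> B'x; apply/mulsgP; exists 1 x; rewrite ?mul1g ?group1.
Qed.

(** Built factor by factor from the projections [divgr] and [remgr] of a direct product. The values
    on the basis serve the rank bound; joint faithfulness serves the induced representation. *)
Lemma dual_basis (A : {group gT}) (b : seq gT) :
  \big[dprod/1]_(x <- b) <[x]> = A ->
  exists theta : nat -> gT -> K,
  [/\ forall i, theta i 1 = 1%R,
      forall i, {in A &, {morph theta i : g h / g * h >-> (g * h)%R}},
      forall i, (i < size b)%N ->
        (#[nth 1 b i]).-primitive_root (theta i (nth 1 b i)),
      forall i j, (i < size b)%N -> (j < size b)%N -> i != j ->
        theta i (nth 1 b j) = 1%R
    & forall g, g \in A -> (forall i, (i < size b)%N -> theta i g = 1%R) -> g = 1].
Proof.
elim: b A => [|x b IH] A.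
  rewrite big_nil => <-; exists (fun _ _ => 1%R); split => //.
  - by move=> i g h _ _; rewrite mulr1.
  - by move=> g /set1P.
rewrite big_cons => defA.
have [[X B defX defB] _ _ _] := dprodP defA.
rewrite defB in defA.
have [_ XB cXB tiXB] := dprodP defA.
have {IH}[theta [theta1 thetaM theta_prim theta_orth theta_inj]] := IH B defB.
have [z prim_z] := exists_primitive_root K (order_gt0 x).
have [chi chiE] := cycle_character prim_z.
have compXB : B \in [complements to <[x]> in A].
  by apply/complP; split.
have cent : B \subset 'C(<[x]>) by [].
have normX : <[x]> <| A by case/dprod_normal2: defA.
have memB j : (j < size b)%N -> nth 1 b j \in B.
  by move=> jb; apply: dprod_cycles_mem defB _; apply: mem_nth.
have memX : x \in <[x]> := cycle_id x.
pose psi i g := if i is i'.+1 then theta i' (remgr <[x]> B g) else chi (divgr <[x]> B g).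
have divA g : g \in A -> divgr <[x]> B g \in <[x]>.
  by move=> Ag; rewrite mem_divgr // XB.
have remA g : g \in A -> remgr <[x]> B g \in B.
  by move=> Ag; rewrite mem_remgr // XB.
have chiM : {in <[x]> &, {morph chi : g h / g * h >-> (g * h)%R}}.
  move=> _ _ /cycleP[k ->] /cycleP[l ->].
  by rewrite -expgD !chiE exprD.
exists psi; split.
- move=> [|i] /=; first by rewrite divgr_id // -(expg0 x) chiE expr0.
  by rewrite remgr1.
- move=> [|i] g h Ag Ah /=; first by rewrite (divgrM compXB cent) // chiM ?divA.
  by rewrite (remgrM compXB normX) // thetaM ?remA.
- move=> [|i] /= ib; last by rewrite remgr_id ?memB //; exact: theta_prim.
  by rewrite divgr_id // -[x in chi x]expg1 chiE expr1.
- move=> [|i] [|j] //= ib jb ij.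
  + rewrite -[nth 1 b j]mul1g divgrMid ?memB //.
    by rewrite -(expg0 x) chiE expr0.
  + by rewrite remgr1.
  + by rewrite remgr_id ?memB //; apply: theta_orth.
move=> g Ag psi1.
have rem1 : remgr <[x]> B g = 1.
  by apply: theta_inj => [|i ib]; [exact: remA|exact: (psi1 i.+1)].
have := psi1 0%N isT => /=.
have /cycleP[k kE] := divA g Ag.
rewrite kE chiE => /eqP; rewrite -(prim_order_dvd prim_z) => /dvdnP[l lk].
by rewrite (divgr_eq <[x]> B g) rem1 kE lk mulnC expgM expg_order expg1n mulg1.
Qed.

End Characters.


(** [rho] is a plain function so that a representation of a larger group can be used directly. *)
Lemma codiagonalize (K : numClosedFieldType) (gT : finGroupType)
    (A : {group gT}) n (rho : gT -> 'M[K]_n) :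
  abelian A -> rho 1%g = 1%:M ->
  {in A &, {morph rho : g h / (g * h)%g >-> g *m h}} ->
  exists2 B : 'M[K]_n, B \in unitmx & exists lam : gT -> 'rV[K]_n,
    {in A, forall g, B *m rho g = diag_mx (lam g) *m B}.
Proof.
move=> cAA rho1 rhoM.
have rhoX g k : g \in A -> rho (g ^+ k)%g = iter k (mulmx (rho g)) 1%:M.
  by move=> Ag; elim: k => [|k IH]; rewrite ?expg0 ?rho1 // expgS rhoM ?groupX //= IH.
have : codiagonalizable [seq rho g | g <- enum A].
  apply/codiagonalizableP; split.
    move=> _ _ /mapP[g + ->] /mapP[h + ->]; rewrite !mem_enum => Ag Ah.
    by rewrite /comm_mx -!rhoM // (centsP cAA g Ag h Ah).
  move=> _ /mapP[g + ->]; rewrite mem_enum => Ag.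
  case: n rho rho1 rhoM rhoX => [|n] rho rho1 rhoM rhoX.
    exists 1%:M; first exact: unitmx1.
    by apply/is_diag_mxP => -[].
  apply/diagonalizableP.
  have [z prim_z] := exists_primitive_root K (order_gt0 g).
  (* The minimal polynomial of [rho g] divides X^o - 1 with o the order of g, whose roots are these
     distinct powers of [z]. *)
  exists [seq z ^+ i | i <- iota 0 #[g]%g].
    rewrite map_inj_in_uniq ?iota_uniq // => i j.
    rewrite !mem_iota !add0n => /andP[_ ig] /andP[_ jg] /eqP.
    by rewrite (eq_prim_root_expr prim_z) !modn_small // => /eqP.
  rewrite big_map.
  have -> : iota 0 #[g]%g = index_iota 0 #[g]%g by rewrite /index_iota subn0.
  rewrite (factor_Xn_sub_1 prim_z); apply: mxminpoly_min.
  rewrite rmorphB rmorphXn rmorph1 /= horner_mx_X.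
  have -> : rho g ^+ #[g]%g = rho (g ^+ #[g]%g)%g.
    by rewrite rhoX // -iter_mulr_1.
  by rewrite expg_order rho1 subrr.
move=> [B unitB /allP/= Bdiag]; exists B => //.
have /choice[lam lamP] g : exists l, g \in A -> B *m rho g = diag_mx l *m B.
  case Ag: (g \in A); last by exists 0.
  have /Bdiag/diagonalizable_forPex[l /(simmxP unitB) lP] :
    rho g \in [seq rho g | g <- enum A] by apply: map_f; rewrite mem_enum.
  by exists l.
by exists lam.
Qed.

(** * Leading monomials of semi-invariants *)

Section Monomials.
Variables (K : numClosedFieldType) (n : nat).
Implicit Types p q : {mpoly K[n]}.

Definition rescale (lam : 'I_n -> K) (k : 'I_n) : {mpoly K[n]} :=
  (lam k)%:MP * 'X_k.

Lemma mcoeff_rescale lam p a :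
  (mmap (@mpolyC n K) (rescale lam) p)@_a = p@_a * \prod_k lam k ^+ a k.
Proof.
rewrite {2}[p]mpolyE /mmap !raddf_sum mulr_suml; apply: eq_bigr => m _ /=.
have -> : mmap1 (rescale lam) m = (\prod_k lam k ^+ m k)%:MP * 'X_[m].
  rewrite mpolyXE_id rmorph_prod -big_split; apply: eq_bigr => k _ /=.
  by rewrite exprMn rmorphXn.
rewrite mulrA -mpolyCM mul_mpolyC !mcoeffZ mcoeffX.
by case: eqP => [->|]; rewrite ?mulr0 ?mul0r ?mulr1.
Qed.

Lemma mlead_rescale lam p : (forall k, lam k != 0) -> p != 0 ->
  mlead (mmap (@mpolyC n K) (rescale lam) p) = mlead p.
Proof.
move=> lam0 p0; set s := mmap _ _ _.
have sE m : (m \in msupp s) = (m \in msupp p).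
  rewrite !mcoeff_msupp mcoeff_rescale mulf_eq0 negb_or.
  have -> : \prod_k lam k ^+ m k != 0.
    by apply/prodf_neq0 => k _; rewrite expf_neq0.
  by rewrite andbT.
have s0 : s != 0 by rewrite -msupp_eq0; have := mlead_supp p0; rewrite -sE; case: msupp.
apply/le_anti/andP; split; apply: msupp_le_mlead; first by rewrite -sE mlead_supp.
by rewrite sE mlead_supp.
Qed.

(* Compare the coefficients of the leading monomials on both sides. *)
Lemma semi_invariant_weight lam (c : K) p q :
  (forall k, lam k != 0) -> p != 0 -> q != 0 ->
  mmap (@mpolyC n K) (rescale lam) p * q =
    c *: (p * mmap (@mpolyC n K) (rescale lam) q) ->
  \prod_k lam k ^ ((mlead p k)%:Z - (mlead q k)%:Z) = c.
Proof.
move=> lam0 p0 q0 /(congr1 (mcoeff (mlead p + mlead q)%MM)).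
rewrite -{1}(mlead_rescale lam0 p0) mcoeffZ -{2}(mlead_rescale lam0 q0) !mleadcM.
rewrite !mlead_rescale // !mcoeff_rescale => E.
have {}E : \prod_k lam k ^+ mlead p k = c * \prod_k lam k ^+ mlead q k.
  have lp0 : mleadc p != 0 by rewrite mleadc_eq0.
  have lq0 : mleadc q != 0 by rewrite mleadc_eq0.
  apply: (mulfI lp0); apply: (mulIf lq0); rewrite E; ring.
have q1 : \prod_k lam k ^+ mlead q k != 0.
  by apply/prodf_neq0 => k _; rewrite expf_neq0.
apply: (mulIf q1); rewrite -E -big_split; apply: eq_bigr => k _ /=.
by rewrite [lam k ^+ mlead q k]exprnP -expfzDr // subrK.
Qed.

(** The terms have pairwise distinct leading monomials, so the largest of these cannot cancel. *)
Lemma homogenize_eq0 r N (p : 'I_r -> {mpoly K[n]}) q (T : {mpoly K[r]}) :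
  (forall i, p i != 0) -> q != 0 ->
  {in msupp T &, injective (fun e : 'X_{1..r} =>
     (\sum_i mlead (p i) *+ e i + mlead q *+ (N - mdeg e))%MM)} ->
  homogenize N p q T = 0 -> T = 0.
Proof.
move=> p0 q0; set L := (X in {in _ &, injective X}) => L_inj H0.
pose hom (e : 'X_{1..r}) : {mpoly K[n]} := \prod_i p i ^+ e i * q ^+ (N - mdeg e).
have prod0 (e : 'X_{1..r}) : \prod_i p i ^+ e i != 0.
  by apply/prodf_neq0 => i _; rewrite expf_neq0.
have mlead_hom e : mlead (hom e) = L e.
  rewrite mleadM ?expf_neq0 // mleadX // mlead_prod; last first.
    by move=> i _ _; rewrite expf_neq0.
  by congr (_ + _)%MM; apply: eq_bigr => i _; rewrite mleadX.
have hom0 e : hom e != 0 by rewrite mulf_neq0 // expf_neq0.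
apply/eqP; apply: contraT => T0.
have sT : (0 < size (msupp T))%N by rewrite lt0n size_eq0 msupp_eq0.
case: (@arg_maxP _ _ _ (Ordinal sT) xpredT
  (fun i : 'I_(size (msupp T)) => L (nth 0%MM (msupp T) i)) isT) => i0 _ i0max.
set e0 := nth 0%MM (msupp T) i0 in i0max.
have e0T : e0 \in msupp T by rewrite mem_nth.
have Lmax e : e \in msupp T -> (L e <= L e0)%O.
  move=> eT; have ei : (index e (msupp T) < size (msupp T))%N by rewrite index_mem.
  by have := i0max (Ordinal ei) isT; rewrite /= nth_index.
have := congr1 (mcoeff (L e0)) H0.
rewrite /homogenize mcoeff0 raddf_sum (bigD1_seq e0) ?msupp_uniq //=.
rewrite [X in _ + X]big_seq_cond [X in _ + X]big1 ?addr0.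
  rewrite mcoeffZ -/(hom e0) -mlead_hom => /eqP; rewrite mulf_eq0 mleadc_eq0.
  by rewrite (negbTE (hom0 _)) orbF mcoeff_eq0 e0T.
move=> e /andP[eT ee0]; rewrite mcoeffZ -/(hom e) [(hom e)@__]mcoeff_gt_mlead ?mulr0 //.
rewrite mlead_hom lt_neqAle Lmax // andbT.
by apply: contraNneq ee0 => /L_inj->.
Qed.

End Monomials.

Lemma prod_expz (K : fieldType) (I : finType) (x : K) (z : I -> int) :
  x != 0 -> \prod_i x ^ z i = x ^ (\sum_i z i).
Proof.
by move=> x0; apply/esym; apply: (big_morph (fun m : int => x ^ m)) => // a b; rewrite expfzDr.
Qed.

Lemma expz_prod (K : fieldType) (I : finType) (x : I -> K) (z : int) :
  (\prod_i x i) ^ z = \prod_i x i ^ z.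
Proof.
by apply: (big_morph (fun y => y ^ z)) => [a b|]; rewrite ?expfzMl ?exp1rz.
Qed.

Lemma prim_expz_dvd (K : fieldType) o (w : K) (z : int) :
  o.-primitive_root w -> w ^ z = 1 -> (o %| `|z|)%N.
Proof.
move=> prim_w; rewrite (prim_order_dvd prim_w); case: z => k.
  by rewrite -exprnP => ->.
by rewrite NegzE -exprnN abszN absz_nat => /eqP; rewrite invr_eq1.
Qed.

(* Dividing a relation by m again gives a relation, so its coefficients are
   divisible by every power of m. *)
Lemma exponents_independent (K : fieldType) r n m (M : 'I_r -> 'I_n -> int)
    (lam : 'I_r -> 'I_n -> K) (o : 'I_r -> nat) :
  (1 < m)%N -> (forall j k, lam j k != 0) ->
  (forall i j, i != j -> \prod_k lam j k ^ M i k = 1) ->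
  (forall j, (o j).-primitive_root (\prod_k lam j k ^ M j k)) ->
  (forall j, (m %| o j)%N) ->
  forall z : 'I_r -> int, (forall k, \sum_i z i * M i k = 0) ->
  forall i, z i = 0.
Proof.
move=> m1 lam0 orth prim mo.
have dvd z : (forall k, \sum_i z i * M i k = 0) -> forall j, (m %| `|z j|)%N.
  move=> rel j; apply: dvdn_trans (mo j) _; apply: prim_expz_dvd (prim j) _.
  (* The relation makes this product of weights trivial; orthogonality leaves only the factor i = j,
     a power of a root of unity of exact order [o j]. *)
  have : \prod_i (\prod_k lam j k ^ M i k) ^ z i = 1.
    under eq_bigr do rewrite expz_prod.
    rewrite exchange_big /= big1 // => k _.
    under eq_bigr do rewrite exprz_exp mulrC.
    by rewrite prod_expz // rel.
  rewrite (bigD1 j) //= [X in _ * X]big1 ?mulr1 // => i ij.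
  by rewrite orth ?exp1rz.
have m0 : (m%:Z != 0) by rewrite -lt0n ltnW.
have dvdX t z : (forall k, \sum_i z i * M i k = 0) ->
    forall j, (m ^ t %| `|z j|)%N.
  elim: t z => [|t IH] z rel j; first by rewrite expn0 dvd1n.
  have zE i : z i = m%:Z * (z i %/ m%:Z)%Z.
    by rewrite mulrC divzK // dvdzE absz_nat dvd.
  rewrite zE abszM absz_nat expnS dvdn_pmul2l ?(ltnW m1) //.
  apply: (IH (fun i => (z i %/ m%:Z)%Z)) => k.
  apply: (mulfI m0); rewrite mulr0 mulr_sumr -[RHS](rel k).
  by apply: eq_bigr => i _; rewrite mulrA -zE.
move=> z rel i; apply/eqP; rewrite -absz_eq0; apply: contraT => zi0.
have := dvdX `|z i|%N z rel i => /dvdn_leq; rewrite lt0n => /(_ zi0).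
by rewrite leqNgt ltn_expl.
Qed.


(** * Algebraic independence of semi-invariants *)

Section RankBound.
Variables (K : numClosedFieldType) (gT : finGroupType).

Section Independence.
Variables (A : {group gT}) (n : nat) (rho : gT -> 'M[K]_n).
Hypotheses (cAA : abelian A) (rho1 : rho 1%g = 1%:M)
  (rhoM : {in A &, {morph rho : g h / (g * h)%g >-> g *m h}}).
Variables (X : Defs.space K) (varX : variety X) (f : ratmap (affine K n) X).
Hypothesis domf : dominant f.
Variable to : action A X.
Hypothesis equ : forall g (v : 'rV[K]_n), g \in A -> rdom f v ->
  rdom f (v *m rho g) -> f (v *m rho g) = to (f v) g.
Variables (r : nat) (theta : 'I_r -> gT -> K) (b : 'I_r -> gT).
Variables (U : set X) (phi : 'I_r -> X -> K) (m : nat).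
Hypotheses (Uo : open U) (phi_reg : forall i, regular_on U (phi i)).
Hypothesis phi_semi : forall i x g, g \in A -> U x ->
  U (to x g) /\ phi i (to x g) = theta i g * phi i x.
Hypothesis phi_neq0 : exists2 x, U x & forall i, phi i x != 0.
Hypotheses (m_gt1 : (1 < m)%N) (bA : forall i, b i \in A)
  (m_order : forall i, (m %| #[b i]%g)%N)
  (theta_prim : forall i, (#[b i]%g).-primitive_root (theta i (b i)))
  (theta_orth : forall i j, i != j -> theta i (b j) = 1).

Lemma semi_invariants_independent (T : {mpoly K[r]}) :
  (forall x, U x -> T.@[fun i => phi i x] = 0) -> T = 0.
Proof.
move=> TU.
have preX : prevariety X by case: varX.
have irrX : irreducible_space X by case: varX.
have [B unitB [lam lamP]] := codiagonalize cAA rho1 rhoM.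
have lam_inv g k : g \in A -> lam g 0 k * lam g^-1%g 0 k = 1.
  move=> Ag; have AgV : g^-1%g \in A by rewrite groupV.
  have : diag_mx (lam g) *m diag_mx (lam g^-1%g) = 1%:M.
    apply: (can_inj (mulmxK unitB)); rewrite mul1mx -mulmxA -lamP // mulmxA.
    by rewrite -lamP // -mulmxA -rhoM // mulgV rho1 mulmx1.
  by move=> /matrixP/(_ k k); rewrite mulmx_diag !mxE eqxx mulr1n.
have lam0 g k : g \in A -> lam g 0 k != 0.
  move=> Ag; have := lam_inv g k Ag; apply: contra_eq_neq => ->.
  by rewrite mul0r eq_sym oner_eq0.
(* Change of coordinates after which [A] acts through the diagonal maps [D g]. *)
pose L := polynomial_map (fun j : 'I_n => \sum_k (B k j)%:MP * 'X_k : {mpoly K[n]}).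
have LE (w : 'rV[K]_n) : L w = w *m B.
  apply/rowP => j; rewrite !mxE [peval _ _]raddf_sum /=; apply: eq_bigr => k _.
  by rewrite mevalM mevalC mevalXU mulrC.
pose D g := polynomial_map (rescale (fun k => lam g 0 k)).
have DE g (w : 'rV[K]_n) : D g w = w *m diag_mx (lam g).
  apply/rowP => j; rewrite mul_mx_diag !mxE pevalM /peval mevalC mevalXU.
  by rewrite mulrC.
have DK g w : g \in A -> D g (D g^-1%g w) = w.
  move=> Ag; apply/rowP => k; rewrite !DE !mul_mx_diag !mxE -mulrA.
  by rewrite [lam g^-1%g 0 k * _]mulrC lam_inv // mulr1.
have LD g w : g \in A -> L (D g w) = (L w : 'rV[K]_n) *m rho g.
  by move=> Ag; rewrite !LE DE -!mulmxA lamP.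
have mL : morphism_on setT L := polynomial_map_morphism _.
have mD g : morphism_on setT (D g) := polynomial_map_morphism _.
have Vo := morphism_preimage_open (@rfun_morphism _ _ _ f) (rdom_open f) Uo.
set V := _ `&` _ in Vo.
have W0o := morphism_preimage_open mL openT Vo; set W0 := _ `&` _ in W0o.
pose F i := phi i \o (f \o L).
have Freg i : regular_on W0 (F i).
  move=> w [_ [fLw ULw]].
  have [_ Lr] := mL w I; have [_ fr] := rfun_morphism fLw.
  by apply: (Lr (phi i \o f)); apply: fr; apply: phi_reg.
have [x0 Ux0 phix0] := phi_neq0.
have phi_open i : i \in enum 'I_r ->
    open (U `&` [set x | phi i x != 0]) /\ U `&` [set x | phi i x != 0] !=set0.
  move=> _; split; last by exists x0; split => //; exact: phix0.
  exact: regular_open_neq0.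
have [PO _] := irreducible_bigI irrX phi_open.
(* A point of V over which no [phi i] vanishes, so that all numerators [p i] will be nonzero. *)
have [||v [_ fv [Uv phiv]]] := dominant_meets domf (openI Uo PO) _ (@openT _) _.
- exists x0; split => // i _; split => //; exact: phix0.
- by exists (0 : 'rV[K]_n).
pose w0 : affine K n := (v : 'rV[K]_n) *m invmx B.
have Lw0 : L w0 = v by rewrite LE mulmxKV.
have W0w0 : W0 w0 by split => //=; rewrite /V /= Lw0.
have [p [q [qw0 FE]]] := common_denominator (fun i => Freg i w0 W0w0).
have p0 i : p i != 0.
  apply: contraTneq (isT : true) => pi0; have [_] := phiv i (mem_enum _ _).
  have := FE _ qw0 i; rewrite /F /= Lw0 => ->.
  by rewrite pi0 [peval 0 _]meval0 mul0r eqxx.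
have q0 : q != 0 by apply: contraNneq qw0 => ->; rewrite [peval 0 _]meval0.
pose W1 := W0 `&` principal_open q.
have W1o : open W1 by apply: openI => //; exact: principal_open_open.
have W1w0 : W1 w0 by split.
(* Semi-invariance with denominators cleared: it holds on the nonempty open set of points of [W1]
   that [D g] maps into [W1], hence as an identity of polynomials. *)
have semi g i : g \in A ->
    mmap (@mpolyC n K) (rescale (fun k => lam g 0 k)) (p i) * q =
    theta i g *: (p i * mmap (@mpolyC n K) (rescale (fun k => lam g 0 k)) q).
  move=> Ag; have Do := morphism_preimage_open (mD g) openT W1o.
  have D0 : [set: affine K n] `&` D g @^-1` W1 !=set0.
    by exists (D g^-1%g w0); split => //=; rewrite DK.
  have W10 : W1 !=set0 by exists w0.
  apply: (peval_inj_on (openI W1o Do) (affine_irreducible W1o Do W10 D0)).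
  move=> w [[[_ [fw Uw]] qw] [_ [[_ [fDw _]] qDw]]].
  have FD : F i (D g w) = theta i g * F i w.
    rewrite /F /= LD // equ //; first exact: (phi_semi _ Ag Uw).2.
    by move: fDw; rewrite LD.
  move: FD; rewrite !FE // => FD.
  rewrite -mul_mpolyC !pevalM [peval _%:MP _]mevalC -!peval_polynomial_map.
  rewrite -/(D g w); move: qw qDw FD; rewrite /principal_open /=.
  set a := peval (p i) (D g w); set c := peval q (D g w).
  set d := peval q w; set e := peval (p i) w => d0 c0 E.
  have -> : a = theta i g * (e / d) * c by rewrite -E divfK.
  by field.
have weight i g : g \in A ->
    \prod_k lam g 0 k ^ ((mlead (p i) k)%:Z - (mlead q k)%:Z) = theta i g.
  move=> Ag; apply: (semi_invariant_weight _ (p0 i) q0 (semi g i Ag)) => k.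
  exact: lam0.
have prim j : (#[b j]%g).-primitive_root
    (\prod_k lam (b j) 0 k ^ ((mlead (p j) k)%:Z - (mlead q k)%:Z)).
  by rewrite weight.
have indep := exponents_independent
  (M := fun i k => (mlead (p i) k)%:Z - (mlead q k)%:Z)
  (lam := fun j k => lam (b j) 0 k) (o := fun j => #[b j]%g) m_gt1
  (fun j k => lam0 _ k (bA j))
  (fun i j ij => etrans (weight i _ (bA j)) (theta_orth ij)) prim m_order.
apply: (@homogenize_eq0 _ _ _ (msize T) p q) => //; last first.
  apply: (peval_inj_on W1o); first by exists w0.
  move=> w [[_ [fw Uw]] qw]; rewrite mevalE_homogenize // [RHS]meval0.
  rewrite -[X in _ * X](_ : T.@[fun i => phi i (f (L w))] = _).
    by rewrite TU // mulr0.
  by apply: meval_eq => i; rewrite -[LHS]/(F i w) FE.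
move=> e e' eT eT' /mnmP Lee; apply/mnmP => i.
have sizeT (a : 'X_{1..r}) : a \in msupp T -> (mdeg a <= msize T)%N.
  by move=> aT; apply: ltnW; apply: msize_mdeg_lt.
suff : (e i)%:Z - (e' i)%:Z = 0 by move/eqP; rewrite subr_eq0 => /eqP[].
apply: (indep (fun i => (e i)%:Z - (e' i)%:Z)) => k.
(* Padding with powers of [q] subtracts [mlead q] once per factor [p i], up to a constant, so the
   leading exponent is affine in [a] and differences of exponents yield linear relations. *)
have LZ (a : 'X_{1..r}) : a \in msupp T ->
    ((\sum_i mlead (p i) *+ a i + mlead q *+ (msize T - mdeg a))%MM k)%:Z =
    \sum_i (a i)%:Z * ((mlead (p i) k)%:Z - (mlead q k)%:Z)
      + (msize T)%:Z * (mlead q k)%:Z.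
  move=> /sizeT aT; rewrite mnmDE mnm_sumE mulmnE PoszD PoszM -subzn //.
  rewrite mdegE !(big_morph Posz PoszD erefl).
  under [in RHS]eq_bigr do rewrite mulrBr.
  rewrite sumrB -mulr_suml mulrBr.
  under eq_bigr do rewrite mulmnE PoszM mulrC.
  ring.
under eq_bigr do rewrite mulrBl.
rewrite sumrB; apply/eqP; rewrite subr_eq0; apply/eqP.
apply: (addIr ((msize T)%:Z * (mlead q k)%:Z)).
by rewrite -!LZ // Lee.
Qed.

End Independence.
End RankBound.


(** * Compressions *)

Section Compressions.
Variables (K : numClosedFieldType) (gT : finGroupType).
Implicit Types (G A : {group gT}).

Lemma rank_le_compression G A d : A \subset G -> abelian A ->
  compression_dim K G d -> ('r(A)%g <= d)%N.
Proof.
move=> sAG cAA [n [rG [X [to [f [_ [varX [_ dimX]] [reg ff] domf equ]]]]]].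
have toA_act : is_action A to.
  case: to {reg ff equ} => t [t_inj tM] /=; split=> // x.
  exact: (sub_in2 (fintype.subsetP sAG) (tM x)).
pose toA : action A X := Action toA_act.
have reg_toA : regular_action toA by move=> g /(fintype.subsetP sAG)/reg.
have ff_toA : faithful_action toA by move=> g /(fintype.subsetP sAG)/ff.
have [b defA ordb] := abelian_structure cAA.
have [theta [theta1 thetaM theta_prim theta_orth _]] := dual_basis K defA.
have size_b : size b = 'r(A)%g by rewrite -size_abelian_type // -ordb size_map.
pose th (i : 'I_(size b)) := theta i.
have thV i g : g \in A -> th i g != 0.
  move=> Ag; have := thetaM i g g^-1%g Ag (groupVr Ag).
  rewrite mulgV theta1 => E; apply: contra_eq_neq E => thg.
  by rewrite -[theta i g]/(th i g) thg mul0r oner_eq0.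
have [U [phi [Uo phi_reg phi_semi [x Ux phix]]]] :=
  semi_invariants varX reg_toA ff_toA (fun i => thetaM (val i) : {in A &, _}) thV.
rewrite -size_b; apply: dimX; exists U, phi; split => //; first by exists x.
(* The last invariant factor divides all the others; the default 2 keeps [m > 1] when [A] is
   trivial. *)
pose m := nth 2 (abelian_type A) (size b).-1.
have m_order (i : 'I_(size b)) : (m %| #[nth 1%g b i]%g)%N.
  have -> : #[nth 1%g b i]%g = nth 2 (abelian_type A) i.
    by rewrite -ordb (nth_map 1%g).
  apply: (@sorted_leq_nth _ [rel m n | n %| m]%N _ _ 2 _ (abelian_type_dvdn_sorted A)).
  - by move=> y z w /= yz zw; exact: dvdn_trans zw yz.
  - by move=> y /=.
  - by rewrite inE -ordb size_map.
  - by rewrite inE -ordb size_map prednK // (leq_ltn_trans _ (ltn_ord i)).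
  by rewrite -ltnS prednK // (leq_ltn_trans _ (ltn_ord i)).
have m_gt1 : (1 < m)%N.
  rewrite /m; have [lt|ge] := ltnP (size b).-1 (size (abelian_type A)).
    by apply: (allP (abelian_type_gt1 A)); rewrite mem_nth.
  by rewrite nth_default.
move=> T; apply: (@semi_invariants_independent K gT A n rG cAA (repr_mx1 rG) _
  X varX f domf toA _ (size b) th (fun i => nth 1%g b i) U phi m) => //.
- by move=> g h Ag Ah; rewrite repr_mxM ?(fintype.subsetP sAG).
- by move=> g v Ag; apply: equ; apply: (fintype.subsetP sAG).
- by exists x => // i; rewrite phix oner_eq0.
- by move=> i; apply: dprod_cycles_mem defA _; rewrite mem_nth.
- by move=> i; exact: theta_prim.
- by move=> i j ij; exact: theta_orth.
Qed.

Lemma compression_of_representation G n (rG : mx_representation K G n) :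
  mx_faithful rG -> compression_dim K G n.
Proof.
(* An action must be injective in the point even for elements outside [G], hence the default [v]. *)
move=> ffG; pose t (v : affine K n) g : affine K n :=
  if g \in G then (v : 'rV[K]_n) *m rG g else v.
have t_act : is_action G t.
  split=> [g v w|v g h Gg Gh]; last first.
    by rewrite /t groupM // Gg Gh repr_mxM // mulmxA.
  rewrite /t; case: ifP => // Gg /(congr1 (mulmxr (rG g^-1%g))) /=.
  by rewrite !(repr_mxK rG Gg).
pose to : action G (affine K n) := Action t_act.
have idm : morphism_on [set: affine K n] (@id (affine K n)).
  by move=> v _; split => // V.
have V0 : [set: affine K n] !=set0 by exists (0 : 'rV[K]_n).
pose f := RatMap openT V0 idm.
exists n, rG, (affine K n), to, f; split=> //.
- by split; [exact: affine_variety|exact: affine_dimension].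
- split=> [g Gg|g Gg toE].
    rewrite (_ : (fun v => to v g) = polynomial_map
       (fun j => \sum_k (rG g k j)%:MP * 'X_k : {mpoly K[n]})).
      exact: polynomial_map_morphism.
    apply/funext => v; apply/rowP => j; rewrite /= /t Gg !mxE.
    rewrite [peval _ _]raddf_sum /=; apply: eq_bigr => k _.
    by rewrite mevalM mevalC mevalXU mulrC.
  apply: (mx_faithful_inj ffG) => //; rewrite repr_mx1; apply/row_matrixP => i.
  by have := toE (row i 1%:M); rewrite /= /t Gg -row_mul mul1mx.
- by move=> O [v Ov] _; exists v; split => //; exists v.
by move=> g Gg v _ _; rewrite /= /t Gg.
Qed.

(** The regular representation is faithful, so some compression exists and the default value in [ed]
    does not intervene. *)
Lemma ed_spec G : compression_dim K G (ed K G) /\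
  forall e, compression_dim K G e -> (ed K G <= e)%N.
Proof.
pose P d := `[< compression_dim K G d >].
have exP : exists d, P d.
  exists #|G|; apply/asboolP.
  apply: (compression_of_representation (rG := regular_repr K G)).
  exact: regular_mx_faithful.
rewrite /ed; set S := [set _ | _].
suff : S (xget 0%N S) by [].
apply: xgetPex; case: (ex_minnP exP) => d /asboolP Pd min_d.
by exists d; split => // e Pe; apply: min_d; apply/asboolP.
Qed.

End Compressions.

(** * Induced representations *)

Section InducedRepresentation.
Variables (K : numClosedFieldType) (gT : finGroupType) (G B : {group gT}) (d : nat).
Variable theta : nat -> gT -> K.
Hypotheses (sBG : B \subset G)
  (theta1 : forall i, theta i 1%g = 1)
  (thetaM : forall i, {in B &, {morph theta i : g h / (g * h)%g >-> g * h}}).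

Let C := {c : {set gT} | c \in rcosets B G}.
Let T : finType := (C * 'I_d)%type.
Let rep (s : T) := repr (val s.1).

Let rep_coset s : (B :* rep s)%g = val s.1.
Proof.
by rewrite /rep; have /rcosetsP[x _ ->] := valP s.1; rewrite rcoset_repr.
Qed.

Let rep_mem s : rep s \in G.
Proof.
rewrite /rep; have /rcosetsP[x Gx ->] := valP s.1.
have /rcosetP[y By ->] := mem_repr_rcoset B x.
by rewrite groupM // (fintype.subsetP sBG).
Qed.

(* Matrix of the sum over i < d of the representations induced from theta i, in
   the basis indexed by right cosets and i. *)
Definition induced_entry g (s t : T) : K :=
  if (s.2 == t.2) && (rep s * g * (rep t)^-1 \in B)%g
  then theta s.2 (rep s * g * (rep t)^-1)%g else 0.

Let coset_inj (s t : T) : s.2 == t.2 -> (rep s * (rep t)^-1)%g \in B -> s = t.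
Proof.
move=> /eqP st2; rewrite -mem_rcoset => /rcoset_eqP; rewrite !rep_coset => st1.
by apply/eqP; rewrite -pair_eqE /= st2 eqxx andbT; apply/eqP/val_inj.
Qed.

Lemma induced_entry1 s t : induced_entry 1%g s t = (s == t)%:R.
Proof.
rewrite /induced_entry mulg1; have [->|st] := eqVneq s t.
  by rewrite eqxx mulgV group1 theta1.
by case: andP => // -[st2 /(coset_inj st2)/eqP]; rewrite (negbTE st).
Qed.

Lemma induced_entryM g h s t : g \in G -> h \in G ->
  \sum_u induced_entry g s u * induced_entry h u t = induced_entry (g * h)%g s t.
Proof.
move=> Gg Gh.
have c0P : (B :* (rep s * g))%g \in rcosets B G.
  by apply/rcosetsP; exists (rep s * g)%g; rewrite ?groupM.
(* The only index with a nonzero entry in row [s]: right multiplication by [g] sends the coset of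
   [s] to that of [u0]. *)
pose u0 : T := (exist (fun c : {set gT} => c \in rcosets B G) _ c0P : C, s.2).
have Bu0 : (rep s * g * (rep u0)^-1)%g \in B.
  by rewrite -mem_rcoset rep_coset /= rcoset_refl.
rewrite (bigD1 u0) //= big1 ?addr0 => [|u uu0].
  rewrite /induced_entry /= eqxx Bu0 /=.
  have -> : (rep s * (g * h) * (rep t)^-1 =
      (rep s * g * (rep u0)^-1) * (rep u0 * h * (rep t)^-1))%g.
    by rewrite !mulgA mulgKV.
  rewrite (groupMl (rep u0 * h * (rep t)^-1)%g Bu0).
  case E: ((s.2 == t.2) && _); last by rewrite mulr0.
  by case/andP: E => _ But; rewrite -(thetaM _ Bu0 But).
rewrite {1}/induced_entry; case: andP => [[su2 Bsu]|]; last by rewrite mul0r.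
case/negP: uu0; apply/eqP/esym/coset_inj; first by [].
have -> : (rep u0 * (rep u)^-1 =
    (rep s * g * (rep u0)^-1)^-1 * (rep s * g * (rep u)^-1))%g.
  by rewrite invMg invgK -[RHS]mulgA mulKg.
by rewrite groupM ?groupV.
Qed.

Let induced_fun g : 'M[K]_#|{: T}| :=
  \matrix_(i, j) induced_entry g (enum_val i) (enum_val j).

Fact induced_mx_repr : mx_repr G induced_fun.
Proof.
split=> [|g h Gg Gh]; apply/matrixP => i j; rewrite !mxE.
  by rewrite induced_entry1 (inj_eq enum_val_inj).
rewrite -induced_entryM //.
under [RHS]eq_bigr do rewrite !mxE.
by rewrite -(big_enum_val (fun u => induced_entry g (enum_val i) u *
  induced_entry h u (enum_val j))).
Qed.

Definition induced_repr := MxRepresentation induced_mx_repr.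

Lemma card_induced : #|{: T}| = (#|G : B|%g * d)%N.
Proof. by rewrite card_prod card_sig card_ord. Qed.

Lemma induced_faithful : (0 < d)%N ->
  (forall g, g \in B -> (forall i, (i < d)%N -> theta i g = 1) -> g = 1%g) ->
  mx_faithful induced_repr.
Proof.
move=> d0 theta_inj; apply/fintype.subsetP => g; rewrite inE => /andP[Gg /eqP].
rewrite mul1mx => /matrixP gE.
have BP : (B : {set gT}) \in rcosets B G.
  by apply/rcosetsP; exists 1%g; rewrite ?mulg1 ?rcoset1.
pose s i (ltid : (i < d)%N) : T :=
  (exist (fun c : {set gT} => c \in rcosets B G) _ BP : C, Ordinal ltid).
pose g' := (repr B * g * (repr B)^-1)%g.
(* A diagonal entry at the coset [B] equals 1 only if [g'] lies in [B], and it is then the value of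
   [theta i]. *)
have g'E i : (i < d)%N -> g' \in B /\ theta i g' = 1.
  move=> ltid; have := gE (enum_rank (s i ltid)) (enum_rank (s i ltid)).
  rewrite !mxE !enum_rankK eqxx /induced_entry eqxx /rep /= -/g'.
  by case: ifP => // _ /eqP; rewrite eq_sym oner_eq0.
have : g' = 1%g by apply: theta_inj => [|i /g'E[]//]; case: (g'E 0%N d0).
by rewrite /g' repr_group invg1 mulg1 mul1g => ->; rewrite set11.
Qed.

End InducedRepresentation.


(** * The bound for quotients *)

Section MainBound.
Variables (K : numClosedFieldType) (gT : finGroupType).

Lemma ed_quotient_le (h : nat -> nat) (G N : {group gT}) :
  rc_bounding K h -> (N <| G)%g ->
  (ed K (G / N)%G <= ed K G * h (ed K G))%N.
Proof.
move=> [_ hrc] nNG; set d := ed K G.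
have comp : compression_dim K G d := (ed_spec K G).1.
(* For d = 0 there is no character to induce; but then every cyclic subgroup of [G] has rank 0, so
   [G] is trivial and has a faithful representation of dimension 0. *)
have [d0|d_gt0] := posnP d.
  have G1 : G :=: 1%g.
    apply/trivgP/fintype.subsetP => g Gg; rewrite inE.
    rewrite -cycle_eq1; apply: contraT => g1.
    have := rank_le_compression (A := <[g]>%G) _ (cycle_abelian g) comp.
    rewrite cycle_subG Gg d0 => /(_ isT).
    by rewrite leqNgt rank_gt0 g1.
  rewrite d0 mul0n; apply: (ed_spec K (G / N)%G).2.
  have rep0 : mx_repr (G / N)%G (fun=> 1%:M : 'M[K]_0).
    by split=> // x y _ _; rewrite mulmx1.
  apply: (compression_of_representation (rG := MxRepresentation rep0)).
  apply/fintype.subsetP => x; rewrite inE => /andP[].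
  by rewrite /= /quotient G1 morphim1.
have [n [rG [X [to [f [ffG [varX dimX] [reg ff] domf equ]]]]]] := comp.
have [A [nAG cAA indA]] := hrc d X varX
  (dominant_rationally_connected varX domf) dimX gT G
  (faithful_action_Bir varX reg ff).
have sAG := normal_sub nAG.
have rkA := rank_le_compression sAG cAA comp.
have cBB : abelian (A / N)%g := quotient_abelian N cAA.
have sBG : (A / N)%G \subset (G / N)%G := quotientS N sAG.
have rkB : ('r(A / N) <= d)%N%g.
  by apply: leq_trans rkA; exact: quotient_rank_abelian.
have [b defB ordb] := abelian_structure cBB.
have [theta [theta1 thetaM _ _ theta_inj]] := dual_basis K defB.
have size_b : (size b <= d)%N.
  by rewrite (leq_trans _ rkB) // -size_abelian_type // -ordb size_map.
have ffI := induced_faithful sBG theta1 thetaM d_gt0.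
(* The basis may have fewer than [d] elements; the characters of its first [size b] indices already
   separate the elements. *)
have {}ffI := ffI (fun g Bg th1 => theta_inj g Bg
  (fun i ib => th1 i (leq_trans ib size_b))).
apply: leq_trans ((ed_spec K (G / N)%G).2 _ (compression_of_representation ffI)) _.
rewrite card_induced mulnC leq_mul2l; apply/orP; right.
apply: leq_trans indA; apply: dvdn_leq; first exact: indexg_gt0.
by apply: index_quotient; rewrite (fintype.subset_trans (finset.subsetIl _ _)) // normal_norm.
Qed.

End MainBound.

Theorem corollaryG (R : realType) (j : nat -> int) (h : nat -> nat)
    (hj : jordan_bounding R[i] j) (hh : rc_bounding R[i] h)
    (gT : finGroupType) (G N : {group gT}) (nNG : (N <| G)%g) :
  (ed R[i] (G / N)%G)%:Z <=
    (ed R[i] G)%:Z * (h (ed R[i] G))%:Z * j (ed R[i] G * h (ed R[i] G))%N.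
Proof.
set d := ed _ G; set n := (d * h d)%N.
have j1 : 1 <= j n.
  have [|A [_ _]] := hj n gT 1%G.
    have rep1 : mx_repr 1%G (fun _ : gT => 1%:M : 'M[R[i]]_n).
      by split=> // x y _ _; rewrite mulmx1.
    exists (MxRepresentation rep1); apply/fintype.subsetP => x.
    by rewrite inE => /andP[].
  by apply: le_trans; rewrite lez_nat indexg_gt0.
rewrite -PoszM -/n; apply: (@le_trans _ _ n%:Z).
  by rewrite lez_nat; exact: ed_quotient_le.
by rewrite ler_peMr.
Qed.
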